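(* Let $K$ be an algebraically closed field and let $\Lambda=KQ$ be a finite dimensional hereditary $K$-algebra such that the underlying graph $\overline{Q}$ of the quiver $Q$ is a Dynkin diagram $\mathbb{A}_n$ for some positive integer $n$. Then: (a) If $|a^-|\le 1$ for every $a\in Q_0$ and there exists a vertex $b\in Q_0$ such that $|b^+|=2$, then $\Lambda$ is right $(n-1)$-Nakayama. (b) If there exists a vertex $b\in Q_0$ such that $|b^-|=2$, then $\Lambda$ is right $n$-Nakayama.
   Context: For a vertex $i\in Q_0$, $i^+$ denotes the set of arrows starting at $i$ and $i^-$ the set of arrows ending at $i$. Paths are composed from left to right ($\alpha\beta$ means first $\alpha$, then $\beta$), so that right $KQ$-modules correspond to (covariant) representations of $Q$ and the indecomposable projective right module at a vertex $a$ has as basis the paths starting at $a$. All modules are finitely generated right modules. For a module $M$ put $\mathrm{rad}^0(M)=M$, $\mathrm{rad}^{i+1}(M)=\mathrm{rad}(\mathrm{rad}^i(M))$. A module is uniserial if it has a unique composition series (the zero module counts as uniserial). Let $M$ be a nonzero module of length $l$. $M$ is $1$-factor serial if it is uniserial; for $l\ge m>1$, $M$ is $m$-factor serial if $M/\mathrm{rad}^{l-m}(M)$ is uniserial and $M/\mathrm{rad}^{l-m+1}(M)$ is not uniserial. $\Lambda$ is right $m$-Nakayama if every indecomposable right $\Lambda$-module is $i$-factor serial for some $1\le i\le m$ and there exists at least one indecomposable $m$-factor serial right $\Lambda$-module. *)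

(* Defs.v *)
From HB Require Import structures.
From mathcomp Require Import all_boot all_algebra.
From mathcomp Require Import finmap monalg.
From mathcomp Require Import boolp classical_sets.

Set Implicit Arguments.
Unset Strict Implicit.
Unset Printing Implicit Defensive.

Import GRing.Theory.
Local Open Scope ring_scope.
Local Open Scope quotient_scope.
Local Open Scope classical_set_scope.

Record quiver := Quiver {
  Q0 : finType;
  Q1 : finType;
  src : Q1 -> Q0;
  tgt : Q1 -> Q0
}.

Definition out_arrows (Q : quiver) (a : Q0 Q) : {set Q1 Q} :=
  finset (fun al : Q1 Q => src al == a).

Definition in_arrows (Q : quiver) (a : Q0 Q) : {set Q1 Q} :=
  finset (fun al : Q1 Q => tgt al == a).

(* The underlying graph of Q is the path graph with n vertices: f numbers the
   vertices and g numbers the edges so that edge number k joins the vertices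
   number k and k.+1, whatever the orientation of the arrow. *)
Definition underlying_An (Q : quiver) (n : nat) : Prop :=
  exists (f : 'I_n -> Q0 Q) (g : 'I_n.-1 -> Q1 Q),
    [/\ bijective f, bijective g &
        forall (i j : 'I_n) (k : 'I_n.-1), i = k :> nat -> j = k.+1 :> nat ->
          src (g k) = f i /\ tgt (g k) = f j \/
          src (g k) = f j /\ tgt (g k) = f i].

Section Paths.
Variable Q : quiver.

Fixpoint chain (a : Q0 Q) (s : seq (Q1 Q)) : bool :=
  if s is al :: s' then (src al == a) && chain (tgt al) s' else true.

(* A path is its starting vertex together with its list of arrows; the list is
   empty for the trivial path e_a. *)
Record qpath := QPath {
  qpath_val : Q0 Q * seq (Q1 Q);
  _ : chain qpath_val.1 qpath_val.2
}.

HB.instance Definition _ := [isSub for qpath_val].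
HB.instance Definition _ := [Choice of qpath by <:].

Definition pstart (p : qpath) : Q0 Q := (qpath_val p).1.
Definition parrows (p : qpath) : seq (Q1 Q) := (qpath_val p).2.
Definition pend (p : qpath) : Q0 Q := last (pstart p) (map (@tgt Q) (parrows p)).

Definition ptriv (a : Q0 Q) : qpath := @QPath (a, [::]) isT.

Lemma chain_cat a s t :
  chain a (s ++ t) = chain a s && chain (last a (map (@tgt Q) s)) t.
Proof. by elim: s a => //= al s IHs a; rewrite IHs andbA. Qed.

(* Paths compose from left to right: first p, then q. *)
Definition path_comp (p q : qpath) : option qpath :=
  if pend p == pstart q then insub (pstart p, parrows p ++ parrows q) else None.

Lemma path_compP p q : pend p = pstart q ->
  exists r, [/\ path_comp p q = Some r, pstart r = pstart p, pend r = pend q &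
                parrows r = parrows p ++ parrows q].
Proof.
move=> e; rewrite /path_comp e eqxx.
have h : chain (pstart p) (parrows p ++ parrows q).
  rewrite chain_cat (valP p) /=.
  by rewrite -/(parrows p) -/(pstart p) -/(pend p) e (valP q).
exists (Sub (pstart p, parrows p ++ parrows q) h); split => //.
  by rewrite insubT.
by rewrite /pend /parrows /pstart /= map_cat last_cat -/(parrows p) -/(pstart p)
           -/(pend p) e.
Qed.

Lemma qpath_eq (p q : qpath) :
  pstart p = pstart q -> parrows p = parrows q -> p = q.
Proof.
move=> h1 h2; apply: val_inj; rewrite /= [LHS]surjective_pairing.
by rewrite [RHS]surjective_pairing; congr pair.
Qed.

Lemma path_comp_None p q : (pend p == pstart q) = false -> path_comp p q = None.
Proof. by rewrite /path_comp => ->. Qed.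

Lemma path_compA p q r :
  obind (path_comp p) (path_comp q r) = obind (fun s => path_comp s r) (path_comp p q).
Proof.
have [e1|n1] := eqVneq (pend p) (pstart q); last first.
  rewrite (path_comp_None (negPf n1)) /=.
  have [e2|n2] := eqVneq (pend q) (pstart r).
    have [s [-> es _ _]] /= := path_compP e2.
    by rewrite path_comp_None // es (negPf n1).
  by rewrite (path_comp_None (negPf n2)).
have [s [-> s1 s2 s3]] /= := path_compP e1.
have [e2|n2] := eqVneq (pend q) (pstart r); last first.
  by rewrite (path_comp_None (negPf n2)) /= path_comp_None // s2 (negPf n2).
have [t [-> t1 t2 t3]] /= := path_compP e2.
have [|u [-> u1 u2 u3]] := @path_compP p t; first by rewrite t1.
have [|v [-> v1 v2 v3]] := @path_compP s r; first by rewrite s2.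
congr Some; apply: qpath_eq; first by rewrite u1 v1 s1.
by rewrite u3 v3 t3 s3 catA.
Qed.

Lemma path_comp_triv_l a p : path_comp (ptriv a) p = if a == pstart p then Some p else None.
Proof.
have [e|n] := eqVneq a (pstart p); last by rewrite path_comp_None ?(negPf n).
have [|u [-> u1 u2 u3]] := @path_compP (ptriv a) p; first by [].
by congr Some; apply: qpath_eq; rewrite ?u1.
Qed.

Lemma path_comp_triv_r a p : path_comp p (ptriv a) = if a == pend p then Some p else None.
Proof.
have [e|n] := eqVneq a (pend p); last by rewrite path_comp_None // eq_sym (negPf n).
have [|u [-> u1 u2 u3]] := @path_compP p (ptriv a); first by [].
by congr Some; apply: qpath_eq; rewrite ?u1 // u3 cats0.
Qed.

End Paths.

(* The path algebra KQ: finitely supported K-valued functions on the paths. *)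
Definition pathalg (K : fieldType) (Q : quiver) : Type := {malg K[qpath Q]}.

Section PathAlgebra.
Variables (K : fieldType) (Q : quiver).
Local Notation A := (pathalg K Q).
Implicit Types (x y z : A) (p q r : qpath Q).

HB.instance Definition _ := GRing.Lmodule.on A.

Definition basis_opt (c : K) (o : option (qpath Q)) : A :=
  if o is Some r then << c *g r >> else 0.

Definition pathalg_mul x y : A :=
  \sum_(p <- msupp x) \sum_(q <- msupp y) basis_opt (x@_p * y@_q) (path_comp p q).

Definition pathalg_one : A := \sum_(a : Q0 Q) << ptriv a >>.

Lemma basis_opt0 o : basis_opt 0 o = 0.
Proof. by case: o => //= r; exact: monalgU0. Qed.

Lemma basis_optD c d o : basis_opt (c + d) o = basis_opt c o + basis_opt d o.
Proof. by case: o => [r|] /=; [exact: monalgUD | rewrite addr0]. Qed.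

Lemma pathalg_mulw (d1 d2 : {fset qpath Q}) x y :
  (msupp x `<=` d1)%fset -> (msupp y `<=` d2)%fset ->
  pathalg_mul x y =
  \sum_(p <- d1) \sum_(q <- d2) basis_opt (x@_p * y@_q) (path_comp p q).
Proof.
move=> le_d1 le_d2; rewrite /pathalg_mul (big_fset_incl _ le_d1) /=.
  apply/eq_bigr=> p _; apply/big_fset_incl => // q _ /mcoeff_outdom ->.
  by rewrite mulr0 basis_opt0.
move=> p _ /mcoeff_outdom xp.
by rewrite big1 => // q _; rewrite xp mul0r basis_opt0.
Qed.

Lemma pathalg_mul0x : left_zero (0 : A) pathalg_mul.
Proof. by move=> x; rewrite /pathalg_mul msupp0 big_seq_fset0. Qed.

Lemma pathalg_mulx0 : right_zero (0 : A) pathalg_mul.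
Proof.
by move=> x; rewrite /pathalg_mul big1 // => p _; rewrite msupp0 big_seq_fset0.
Qed.

Lemma pathalg_mulDl : left_distributive pathalg_mul +%R.
Proof.
move=> x y z.
rewrite (pathalg_mulw (msuppD_le x y) (fsubset_refl _)).
rewrite (pathalg_mulw (fsubsetUl (msupp x) (msupp y)) (fsubset_refl (msupp z))).
rewrite (pathalg_mulw (fsubsetUr (msupp x) (msupp y)) (fsubset_refl (msupp z))).
rewrite -big_split /=; apply/eq_bigr=> p _.
rewrite -big_split /=; apply/eq_bigr=> q _.
by rewrite mcoeffD mulrDl basis_optD.
Qed.

Lemma pathalg_mulDr : right_distributive pathalg_mul +%R.
Proof.
move=> z x y.
rewrite (pathalg_mulw (fsubset_refl _) (msuppD_le x y)).
rewrite (pathalg_mulw (fsubset_refl (msupp z)) (fsubsetUl (msupp x) (msupp y))).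
rewrite (pathalg_mulw (fsubset_refl (msupp z)) (fsubsetUr (msupp x) (msupp y))).
rewrite -big_split /=; apply/eq_bigr=> p _.
rewrite -big_split /=; apply/eq_bigr=> q _.
by rewrite mcoeffD mulrDr basis_optD.
Qed.

Lemma pathalg_mul_suml (I : Type) (s : seq I) (F : I -> A) x :
  pathalg_mul (\sum_(i <- s) F i) x = \sum_(i <- s) pathalg_mul (F i) x.
Proof.
exact: (big_morph (pathalg_mul^~ x) (fun _ _ => pathalg_mulDl _ _ _)
                  (pathalg_mul0x x)).
Qed.

Lemma pathalg_mul_sumr (I : Type) (s : seq I) (F : I -> A) x :
  pathalg_mul x (\sum_(i <- s) F i) = \sum_(i <- s) pathalg_mul x (F i).
Proof.
exact: (big_morph (pathalg_mul x) (fun _ _ => pathalg_mulDr _ _ _)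
                  (pathalg_mulx0 x)).
Qed.

Lemma pathalg_mulUU c d p q :
  pathalg_mul << c *g p >> << d *g q >> = basis_opt (c * d) (path_comp p q).
Proof.
by rewrite (pathalg_mulw msuppU_le msuppU_le) !big_seq_fset1 !mcoeffUU.
Qed.

Lemma pathalg_mulA : associative pathalg_mul.
Proof.
have UA c d e p q r : pathalg_mul << c *g p >> (pathalg_mul << d *g q >> << e *g r >>)
    = pathalg_mul (pathalg_mul << c *g p >> << d *g q >>) << e *g r >>.
  rewrite !pathalg_mulUU.
  have -> : pathalg_mul << c *g p >> (basis_opt (d * e) (path_comp q r))
      = basis_opt (c * (d * e)) (obind (path_comp p) (path_comp q r)).
    by case: (path_comp q r) => [s|] /=; rewrite ?pathalg_mulUU ?pathalg_mulx0.
  have -> : pathalg_mul (basis_opt (c * d) (path_comp p q)) << e *g r >>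
      = basis_opt (c * d * e) (obind (fun s => path_comp s r) (path_comp p q)).
    by case: (path_comp p q) => [s|] /=; rewrite ?pathalg_mulUU ?pathalg_mul0x.
  by rewrite mulrA path_compA.
move=> x y z.
rewrite (monalgE x) pathalg_mul_suml [X in _ = pathalg_mul X _]pathalg_mul_suml.
rewrite pathalg_mul_suml; apply: eq_bigr => p _.
rewrite (monalgE y) pathalg_mul_suml [X in _ = pathalg_mul X _]pathalg_mul_sumr.
rewrite pathalg_mul_sumr pathalg_mul_suml; apply: eq_bigr => q _.
rewrite (monalgE z) [X in pathalg_mul _ X = _]pathalg_mul_sumr.
by rewrite !pathalg_mul_sumr; apply: eq_bigr => r _; exact: UA.
Qed.

Lemma pathalg_mul1x : left_id pathalg_one pathalg_mul.
Proof.
move=> x; rewrite [in LHS](monalgE x) pathalg_mul_sumr [RHS]monalgE.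
apply: eq_bigr => p _; rewrite pathalg_mul_suml (bigD1 (pstart p)) //=.
rewrite big1 => [|a na]; rewrite pathalg_mulUU path_comp_triv_l.
  by rewrite eqxx mul1r addr0.
by rewrite (negPf na).
Qed.

Lemma pathalg_mulx1 : right_id pathalg_one pathalg_mul.
Proof.
move=> x; rewrite [in LHS](monalgE x) pathalg_mul_suml [RHS]monalgE.
apply: eq_bigr => p _; rewrite pathalg_mul_sumr (bigD1 (pend p)) //=.
rewrite big1 => [|a na]; rewrite pathalg_mulUU path_comp_triv_r.
  by rewrite eqxx mulr1 addr0.
by rewrite (negPf na).
Qed.

(* No nonzero ring structure: KQ is the zero ring when Q has no vertex. *)
HB.instance Definition _ := GRing.Zmodule_isPzRing.Build A
  pathalg_mulA pathalg_mul1x pathalg_mulx1 pathalg_mulDl pathalg_mulDr.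

Lemma pathalg_scalerAl (k : K) x y : k *: (x * y) = (k *: x) * y.
Proof.
rewrite [RHS](pathalg_mulw (msuppZ_le k x) (fsubset_refl (msupp y))).
rewrite scaler_sumr; apply: eq_bigr => p _.
rewrite scaler_sumr; apply: eq_bigr => q _; rewrite mcoeffZ -mulrA.
case: (path_comp p q) => [r|] /=; last by rewrite scaler0.
by apply/malgP => r'; rewrite mcoeffZ !mcoeffU mulrnAr.
Qed.

Lemma pathalg_scalerAr (k : K) x y : k *: (x * y) = x * (k *: y).
Proof.
rewrite [RHS](pathalg_mulw (fsubset_refl (msupp x)) (msuppZ_le k y)).
rewrite scaler_sumr; apply: eq_bigr => p _.
rewrite scaler_sumr; apply: eq_bigr => q _; rewrite mcoeffZ mulrCA.
case: (path_comp p q) => [r|] /=; last by rewrite scaler0.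
by apply/malgP => r'; rewrite mcoeffZ !mcoeffU mulrnAr.
Qed.

End PathAlgebra.

(* A right A-module is a left module over the converse ring A^c. *)
Notation rmodType A := (lmodType A^c).

Definition finitely_generated (R : pzRingType) (M : lmodType R) : Prop :=
  exists s : seq M, forall x : M, exists c : 'I_(size s) -> R,
    x = \sum_(i < size s) c i *: s`_i.

Definition projective (R : pzRingType) (P : lmodType R) : Prop :=
  forall (M N : lmodType R) (g : {linear M -> N}) (h : {linear P -> N}),
    (forall y, exists x, g x = y) ->
    exists h' : {linear P -> M}, forall p, g (h' p) = h p.

(* Every right ideal of A, that is, every right module I which embeds in the
   regular right module, is projective. *)
Definition right_hereditary (A : pzRingType) : Prop :=
  forall (I : rmodType A) (f : {linear I -> (A^c)^o}),
    injective f -> projective I.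

Section Submodules.
Variables (R : pzRingType) (M : lmodType R).

Record submodule := Submodule {
  submod_set :> set M;
  submod0 : submod_set 0;
  submodP : forall (a : R) (x y : M),
    submod_set x -> submod_set y -> submod_set (a *: x + y)
}.

Definition submodT : submodule := @Submodule setT I (fun _ _ _ _ _ => I).

Definition maximal_submodule (V U : submodule) : Prop :=
  V `<` U /\
  forall W : submodule, V `<=` W -> W `<=` U ->
    W = V :> set M \/ W = U :> set M.

Definition rad_set (N : submodule) : set M :=
  [set x | submod_set N x /\
            forall V : submodule, maximal_submodule V N -> submod_set V x].

Lemma rad_set0 N : rad_set N 0.
Proof. by split=> [|V _]; exact: submod0. Qed.

Lemma rad_setP N (a : R) (x y : M) :
  rad_set N x -> rad_set N y -> rad_set N (a *: x + y).
Proof.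
move=> [Nx Vx] [Ny Vy]; split=> [|V mV]; first exact: submodP.
by apply: submodP; [exact: Vx | exact: Vy].
Qed.

(* The radical of N, a submodule of M: the intersection of the maximal
   submodules of N (N itself if it has none). *)
Definition rad (N : submodule) : submodule :=
  Submodule (@rad_set0 N) (@rad_setP N).

Fixpoint rad_iter (k : nat) : submodule :=
  if k is k'.+1 then rad (rad_iter k') else submodT.

(* 0 = U 0 < U 1 < ... < U l = M, each U i being maximal in U i.+1; the values
   of U beyond l are irrelevant. *)
Definition composition_series (l : nat) (U : nat -> submodule) : Prop :=
  [/\ U 0 = [set 0] :> set M, U l = [set: M] :> set M &
      forall i, (i < l)%N -> maximal_submodule (U i) (U i.+1)].

Definition has_length (l : nat) : Prop := exists U, composition_series l U.

Definition uniserial : Prop :=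
  exists l U, composition_series l U /\
    forall l' U', composition_series l' U' ->
      l' = l /\ forall i, (i <= l)%N -> U' i = U i :> set M.

Definition nonzero_module : Prop := exists x : M, x <> 0.

Definition indecomposable : Prop :=
  nonzero_module /\
  forall U V : submodule,
    U `&` V = [set 0] ->
    (forall x : M, exists u v, [/\ submod_set U u, submod_set V v & x = u + v]) ->
    U = [set 0] :> set M \/ V = [set 0] :> set M.

Section Quotient.
Variable N : submodule.

Definition submod_pred : {pred M} := fun x => `[< submod_set N x >].

Lemma submod_pred_zmod_closed : zmod_closed submod_pred.
Proof.
split=> [|x y]; first by apply/asboolP; exact: submod0.
move=> /asboolP Nx /asboolP Ny; apply/asboolP.
by rewrite addrC -scaleN1r; exact: submodP.
Qed.

HB.instance Definition _ :=
  GRing.isZmodClosed.Build M submod_pred submod_pred_zmod_closed.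

Definition quotmod : Type := Quotient.quot submod_pred.

HB.instance Definition _ := GRing.Zmodule.on quotmod.

Definition quotmod_proj (x : M) : quotmod := \pi_(Quotient.quot submod_pred) x.

Definition quotmod_scale (a : R) (u : quotmod) : quotmod :=
  quotmod_proj (a *: repr u).

Lemma quotmod_projP x y : quotmod_proj x = quotmod_proj y <-> submod_set N (x - y).
Proof.
split=> [/eqP|h]; last apply/eqP; rewrite -Quotient.idealrBE; last exact/asboolP.
by move/asboolP.
Qed.

Lemma quotmod_projD x y : quotmod_proj (x + y) = quotmod_proj x + quotmod_proj y.
Proof. exact: raddfD. Qed.

Lemma quotmod_projK (u : quotmod) : quotmod_proj (repr u) = u.
Proof. exact: reprK. Qed.

Lemma quotmod_projZ a x : quotmod_proj (a *: x) = quotmod_scale a (quotmod_proj x).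
Proof.
apply/quotmod_projP; rewrite -scalerBr -[_ *: _]addr0.
by apply: submodP; [apply/quotmod_projP; rewrite quotmod_projK | exact: submod0].
Qed.

Lemma quotmod_scalerA a b u :
  quotmod_scale a (quotmod_scale b u) = quotmod_scale (a * b) u.
Proof. by rewrite -(quotmod_projK u) -!quotmod_projZ scalerA. Qed.

Lemma quotmod_scale1r : left_id 1 quotmod_scale.
Proof. by move=> u; rewrite -(quotmod_projK u) -quotmod_projZ scale1r. Qed.

Lemma quotmod_scalerDr : right_distributive quotmod_scale +%R.
Proof.
move=> a u v; rewrite -(quotmod_projK u) -(quotmod_projK v) -quotmod_projD.
by rewrite -!quotmod_projZ scalerDr quotmod_projD.
Qed.

Lemma quotmod_scalerDl u : {morph quotmod_scale^~ u : a b / a + b}.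
Proof.
by move=> a b; rewrite -(quotmod_projK u) -!quotmod_projZ scalerDl quotmod_projD.
Qed.

HB.instance Definition _ := GRing.Zmodule_isLmodule.Build R quotmod
  quotmod_scalerA quotmod_scale1r quotmod_scalerDr quotmod_scalerDl.

End Quotient.
End Submodules.

Arguments has_length {R} M l.
Arguments uniserial {R} M.
Arguments nonzero_module {R} M.
Arguments indecomposable {R} M.
Arguments rad_iter {R} M k.

(* l is the length of M; modules without a composition series are not m-factor
   serial for any m. *)
Definition factor_serial (R : pzRingType) (M : lmodType R) (m : nat) : Prop :=
  nonzero_module M /\
  exists l, has_length M l /\
    ((m = 1%N /\ uniserial M) \/
     [/\ (1 < m <= l)%N,
         uniserial (quotmod (rad_iter M (l - m)%N)) &
         ~ uniserial (quotmod (rad_iter M (l - m + 1)%N))]).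

Definition right_Nakayama (A : pzRingType) (m : nat) : Prop :=
  (forall M : rmodType A, finitely_generated M -> indecomposable M ->
     exists i, (1 <= i <= m)%N /\ factor_serial M i) /\
  (exists M : rmodType A,
     [/\ finitely_generated M, indecomposable M & factor_serial M m]).

(* Main.v *)
From HB Require Import structures.
From mathcomp Require Import boolp classical_sets.
From mathcomp Require Import finmap monalg.
From mathcomp Require Import all_boot all_algebra.
From mathcomp Require Import zify.
Require Import Defs.

(* An indecomposable representation of a quiver of type A_n is thin, with support
   an interval.  To see this, pull the zero space and the vertex spaces back from
   right to left along the arrows, read as linear relations: this gives a finite
   filtration of the leftmost nonzero vertex space.  A line in its first nonzero
   step, together with any complement, extends step by step to the right to a thin
   direct summand, which must be everything.
   Submodules of a thin module are the sets of support vertices closed under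
   successors, and the radical removes the sources.  So a nonuniserial thin module
   of length l is m-factor serial with m <= l <= n, and with m < l when it has a
   unique source, which is automatic if no vertex is the target of two arrows.  The
   bounds are attained by the representation with K at every vertex: it has two
   sources in case (b), and in case (a) its radical has two sources. *)

Set Implicit Arguments.
Unset Strict Implicit.
Unset Printing Implicit Defensive.

Import GRing.Theory.
Local Open Scope ring_scope.

(** * Closed subsets of a finite acyclic relation *)

(** Modelling submodules by successor-closed sets of vertices turns lengths into cardinalities and
    maximal submodules into removals of one source, so that every clause of [factor_serial] becomes
    a statement about finite sets. Acyclicity is used as a height that grows along arrows; sources
    are elements of minimal height. The obstacle in the classification is that a summand must split
    off at all vertices at once: a line with a complement at one vertex may have no matching
    complement at the next. So a line travels as a vector [a] with a functional [phi] such that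
    [phi a = 1], the complement being the kernel of [phi], and the invariant kept is compatibility
    with a filtration. The filtration at a vertex must already account for all edges to its right,
    which is why it is built from the right end although the line is extended from the left. No
    bases are chosen: the functionals come from Zorn's lemma, and the natural-number indexing of the
    filtration is what provides a first step with a given property. *)

Section ClosedSets.
Variables (T : finType) (r : rel T) (h : T -> nat).
Hypothesis r_mono : forall x y, r x y -> (h x < h y)%N.
Implicit Types (x y : T) (I C D : {set T}).

Definition closed_in I C : Prop :=
  C \subset I /\ forall x y, x \in C -> y \in I -> r x y -> y \in C.

Lemma closed_inT I : closed_in I I.
Proof. by split. Qed.

Lemma closed_in0 I : closed_in I set0.
Proof. by split=> [|x y]; rewrite ?sub0set // inE. Qed.

Lemma closed_inU I C D : closed_in I C -> closed_in I D -> closed_in I (C :|: D).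
Proof.
move=> [sC cC] [sD cD]; split=> [|x y]; first by rewrite subUset sC.
rewrite !inE => /orP[xC|xD] yI rxy; apply/orP.
  by left; apply: cC rxy.
by right; apply: cD rxy.
Qed.

Lemma closed_inI I C D : closed_in I C -> closed_in I D -> closed_in I (C :&: D).
Proof.
move=> [sC cC] [sD cD]; split=> [|x y].
  by apply: subset_trans (subsetIl _ _) sC.
by rewrite !inE => /andP[xC xD] yI rxy; apply/andP; split; [exact: cC rxy | exact: cD rxy].
Qed.

Lemma closed_in_source I x : ~~ [exists y in I, r y x] -> closed_in I (I :\ x).
Proof.
move=> nx; split=> [|y z]; first exact: subsetDl.
rewrite !inE => /andP[_ yI] zI ryz; rewrite zI andbT.
by apply: contraNneq nx => zx; apply/existsP; exists y; rewrite yI -zx.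
Qed.

Lemma closed_in_trans I C D : closed_in I C -> closed_in C D -> closed_in I D.
Proof.
move=> [sC cC] [sD cD]; split=> [|x y xD yI rxy]; first exact: subset_trans sC.
by apply: (cD x y) => //; apply: (cC x y) => //; apply: (subsetP sD).
Qed.

(* The added element is one of maximal height outside [C]. *)
Lemma closed_in_add I C D : closed_in I C -> closed_in I D -> C \proper D ->
  exists x, [/\ x \in D, x \notin C & closed_in I (x |: C)].
Proof.
move=> [sC cC] [sD cD] /properP[sCD [x0 x0D x0C]].
have P0 : x0 \in D :\: C by rewrite inE x0C x0D.
case: (arg_maxnP h P0) => x /setDP[xD xC] xmax.
exists x; split=> //; split=> [|y z].
  by rewrite subUset sub1set sC andbT (subsetP sD).
rewrite !inE => /orP[/eqP->|yC] zI rz; last by rewrite (cC y z) ?orbT.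
have zD : z \in D by apply: cD rz.
case zC: (z \in C); first by rewrite orbT.
have zDC : z \in D :\: C by rewrite inE zC zD.
by have := xmax z zDC; rewrite /= leqNgt r_mono.
Qed.

Lemma closed_chain I C D : closed_in I C -> closed_in I D -> C \subset D ->
  exists c : nat -> {set T},
    [/\ c 0%N = C, c (#|D| - #|C|)%N = D, forall i, closed_in I (c i),
        forall i, (i <= #|D| - #|C|)%N -> #|c i| = (#|C| + i)%N &
        forall i, (i < #|D| - #|C|)%N -> c i \subset c i.+1].
Proof.
move=> cC cD sCD; move em : (#|D| - #|C|)%N => m.
elim: m C cC sCD em => [|m IHm] C cC sCD em.
  have eCD : C = D by apply/eqP; rewrite eqEcard sCD -subn_eq0 em.
  by exists (fun=> C); split=> // i; rewrite leqn0 => /eqP->; rewrite addn0.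
have pCD : C \proper D by rewrite properEcard sCD -subn_gt0 em.
have [x [xD xC cxC]] := closed_in_add cC cD pCD.
have exC : #|x |: C| = #|C|.+1 by rewrite cardsU1 xC.
have [||c [c0 cm cc cI cS]] := IHm _ cxC.
- by rewrite subUset sub1set xD.
- by rewrite exC subnS em.
exists (fun i => if i is j.+1 then c j else C); split=> //.
- by case.
- by case=> [|i] hi; rewrite ?addn0 // cI // exC addSnnS.
- by case=> [|i] hi; [rewrite c0 subsetUr | apply: cS].
Qed.

(** The flag is made to pass through a prescribed [C], at the index [#|C|]. Hence any submodule is a
    term, of known index, of some composition series. *)
Lemma closed_flag I C : closed_in I C ->
  exists c : nat -> {set T},
    [/\ c #|C| = C, forall i, closed_in I (c i),
        forall i, (i <= #|I|)%N -> #|c i| = i &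
        forall i, (i < #|I|)%N -> c i \subset c i.+1].
Proof.
move=> cC; have sCI := cC.1.
have [c1 []] := closed_chain (closed_in0 I) cC (sub0set C).
rewrite cards0 subn0 => c10 c1C c1c c1k c1s.
have [c2 [c20 c2I c2c c2k c2s]] := closed_chain cC (closed_inT I) sCI.
have leCI := subset_leq_card sCI.
exists (fun i => if (i <= #|C|)%N then c1 i else c2 (i - #|C|)%N); split.
- by rewrite leqnn.
- by move=> i; case: ifP.
- move=> i iI; case: ifPn => [iC|]; first by rewrite c1k.
  by rewrite -ltnNge => Ci; rewrite c2k ?leq_sub2r // subnKC // ltnW.
- move=> i iI; case: (ltngtP i #|C|) => [iC|Ci|eiC].
  + exact: c1s.
  + by rewrite subSn 1?ltnW // c2s // ltn_sub2r // (ltn_trans Ci).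
  + by rewrite eiC c1C subSnn -c20; apply: c2s; rewrite subn_gt0 -eiC.
Qed.
End ClosedSets.

(** * Submodule lattices modelled by closed sets *)

(** An isomorphism from the submodule lattice onto the lattice of closed sets. Injectivity is
    contained in the order equivalence, up to equality of underlying sets, which is the equality
    used by [composition_series]. *)
Definition closed_set_model (T : finType) (r : rel T) (R : pzRingType)
    (M : lmodType R) (I : {set T}) (S : submodule M -> {set T}) : Prop :=
  [/\ forall N, closed_in r I (S N),
      forall N N' : submodule M, (N `<=` N')%classic <-> S N \subset S N' &
      forall C, closed_in r I C -> exists N, S N = C].

Lemma quotmod_proj0 (R : pzRingType) (M : lmodType R) (N : submodule M) :
  quotmod_proj N 0 = 0.
Proof. by apply: (addrI (quotmod_proj N 0)); rewrite -quotmod_projD !addr0. Qed.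

Section Model.
Variables (T : finType) (r : rel T) (h : T -> nat).
Hypothesis r_mono : forall x y, r x y -> (h x < h y)%N.
Variables (R : pzRingType) (M : lmodType R) (I : {set T}).
Variable S : submodule M -> {set T}.
Hypothesis model : closed_set_model r I S.
Implicit Types (N U V W : submodule M) (C D : {set T}).

Lemma model_closed N : closed_in r I (S N).
Proof. by have [+ _ _] := model. Qed.

Lemma model_le N N' : (N `<=` N')%classic <-> S N \subset S N'.
Proof. by have [_ + _] := model. Qed.

Lemma model_onto C : closed_in r I C -> exists N, S N = C.
Proof. by have [_ _ +] := model => /[apply]. Qed.

Lemma model_sub N : S N \subset I.
Proof. exact: (model_closed N).1. Qed.

Lemma model_eq N N' : (N = N' :> set M) <-> S N = S N'.
Proof.
split=> [e|e].
  by apply/eqP; rewrite eqEsubset; apply/andP; split; apply/model_le; rewrite e.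
by apply/seteqP; split; apply/model_le; rewrite e.
Qed.

Lemma model_setT N : (N = [set: M]%classic :> set M) <-> S N = I.
Proof.
split=> [e|e].
  apply/eqP; rewrite eqEsubset model_sub.
  have [N' <-] := model_onto (closed_inT r I).
  by apply/model_le; rewrite e.
apply/seteqP; split=> // x _.
have: (submodT M `<=` N)%classic by apply/model_le; rewrite e model_sub.
exact.
Qed.

Lemma model_set0 N : (N = [set 0]%classic :> set M) <-> S N = set0.
Proof.
have [Z eZ] := model_onto (closed_in0 r I); split=> e.
  apply/eqP; rewrite -subset0 -eZ; apply/model_le; rewrite e => x ->.
  exact: submod0.
apply/seteqP; split=> [x Nx|x ->]; last exact: submod0.
pose Z0set : set M := [set 0]%classic.
have Z0P (a : R) (y z : M) : Z0set y -> Z0set z -> Z0set (a *: y + z).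
  by move=> -> ->; rewrite scaler0 addr0.
have : (N `<=` Submodule (erefl : Z0set 0) Z0P)%classic.
  by apply/model_le; rewrite e sub0set.
by apply.
Qed.

Lemma model_nonzero : I != set0 -> nonzero_module M.
Proof.
move=> I0; apply: contrapT => nz; move/eqP: I0; apply.
have /model_setT <- := erefl (submodT M : set M).
apply/model_set0/seteqP; split=> [x _|x _] //=.
by apply: contrapT => x0; apply: nz; exists x.
Qed.

(** Between two distinct nested closed sets there is one with a single element more than the
    smaller, so covering in the submodule lattice is measured by cardinality. *)
Lemma model_maximal V U :
  maximal_submodule V U <-> S V \subset S U /\ #|S U| = #|S V|.+1.
Proof.
split=> [[[VU nUV] mV]|[sVU e]].
  have sVU : S V \subset S U by apply/model_le.
  have pVU : S V \proper S U.
    by rewrite properE sVU; apply/negP => /model_le.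
  split=> //.
  have [x [xU xV cx]] := closed_in_add r_mono (model_closed V) (model_closed U) pVU.
  have [W eW] := model_onto cx.
  have [|| /model_eq|/model_eq] := mV W.
  - by apply/model_le; rewrite eW subsetUr.
  - by apply/model_le; rewrite eW subUset sub1set xU.
  - by rewrite eW => /setP/(_ x); rewrite setU11 (negPf xV).
  - by rewrite eW => <-; rewrite cardsU1 xV.
split; first split.
- exact/model_le.
- by move=> /model_le/subset_leq_card; rewrite e ltnn.
move=> W /model_le VW /model_le WU.
have [lVW|] := ltnP #|S V| #|S W|.
  right; apply/model_eq/eqP; rewrite eqEcard WU e //.
by move=> lWV; left; apply/model_eq/eqP; rewrite eq_sym eqEcard VW.
Qed.

(** Removing a source of [S N] gives a maximal submodule, so no source survives in the radical.
    Conversely a maximal submodule omits a single element; if that element had a predecessor in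
    [S N], the predecessor would be kept and closure would bring the element back. *)
Lemma model_rad N : S (rad N) = [set x in S N | [exists y in S N, r y x]].
Proof.
apply/eqP; rewrite eqEsubset; apply/andP; split.
  have sNr : S (rad N) \subset S N by apply/model_le => x [].
  apply/subsetP=> x xr; have xN := subsetP sNr x xr; rewrite inE xN /=.
  apply: contraT => nx.
  have cx := closed_in_trans (model_closed N) (closed_in_source nx).
  have [V eV] := model_onto cx.
  have mV : maximal_submodule V N.
    by apply/model_maximal; rewrite eV subsetDl [LHS](cardsD1 x) xN.
  have /subsetP/(_ x xr) : S (rad N) \subset S V.
    by apply/model_le => y [_]; apply.
  by rewrite eV !inE eqxx.
set D := finset _.
have cD : closed_in r I D.
  split=> [|x y].
    by apply/subsetP => x; rewrite inE => /andP[/(subsetP (model_sub N))].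
  rewrite !inE => /andP[xN _] yI rxy; rewrite ((model_closed N).2 x y) //=.
  by apply/existsP; exists x; rewrite xN.
have [W eW] := model_onto cD; rewrite -eW; apply/model_le => w Ww; split.
  suff : (W `<=` N)%classic by apply.
  by apply/model_le; rewrite eW; apply/subsetP => x; rewrite inE => /andP[].
move=> V /model_maximal[VN cV].
suff : (W `<=` V)%classic by apply.
apply/model_le; rewrite eW; apply/subsetP => x; rewrite inE => /andP[xN].
case/existsP=> y /andP[yN ryx].
apply: contraT => xV.
have eN : S N = x |: S V.
  apply/eqP; rewrite eq_sym eqEcard subUset sub1set xN VN /= cV cardsU1 xV //.
move: yN; rewrite eN !inE => /orP[/eqP yx|yV].
  by have := r_mono ryx; rewrite yx ltnn.
by rewrite ((model_closed V).2 y x) ?(subsetP (model_sub N)) in xV.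
Qed.

Lemma model_composition l (U : nat -> submodule M) : composition_series l U ->
  l = #|I| /\ forall i, (i <= l)%N -> #|S (U i)| = i.
Proof.
move=> [/model_set0 U0 /model_setT Ul mU].
have cU i : (i <= l)%N -> #|S (U i)| = i.
  elim: i => [_|i IHi il]; first by rewrite U0 cards0.
  by have /model_maximal[_ ->] := mU i il; rewrite IHi // ltnW.
by split=> //; rewrite -Ul cU.
Qed.

Lemma model_series C : closed_in r I C ->
  exists U : nat -> submodule M, composition_series #|I| U /\ S (U #|C|) = C.
Proof.
move=> cC; have [c [cC' cc ck cs]] := closed_flag r_mono cC.
have /choice[U eU] : forall i, exists N, S N = c i by move=> i; apply: model_onto.
exists U; split; last by rewrite eU.
split.
- by apply/model_set0; rewrite eU; apply: cards0_eq; rewrite ck.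
- apply/model_setT; rewrite eU; apply/eqP.
  by rewrite eqEcard ck // leqnn andbT; exact: (cc _).1.
- by move=> i iI; apply/model_maximal; rewrite !eU cs // !ck // ltnW.
Qed.

Lemma model_length : has_length M #|I|.
Proof. by have [U [sU _]] := model_series (closed_inT r I); exists U. Qed.

(** A composition series is a flag of closed sets of sizes 0, 1, 2 and so on, and every closed set
    occurs in one of them at the index of its size. Uniqueness of the series is thus uniqueness of
    the closed set of each size. *)
Lemma model_uniserial : uniserial M <->
  forall C D, closed_in r I C -> closed_in r I D -> #|C| = #|D| -> C = D.
Proof.
split=> [[l [U [sU uU]]] C D cC cD eCD|uI].
  have [UC [sC eC]] := model_series cC; have [UD [sD eD]] := model_series cD.
  have [el hC] := uU _ _ sC; have [_ hD] := uU _ _ sD.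
  have lC : (#|C| <= l)%N by rewrite -el subset_leq_card // cC.1.
  rewrite -eC -eD -eCD; apply/model_eq; rewrite hC // hD //.
have [U [sU _]] := model_series (closed_inT r I); exists #|I|, U; split=> //.
move=> l' U' sU'; have [el cU'] := model_composition sU'.
have [_ cU] := model_composition sU.
split=> // i iI; apply/model_eq; apply: uI; rewrite ?cU ?cU' ?el //;
exact: model_closed.
Qed.

Lemma model_indecomposable : I != set0 ->
  (forall C D, closed_in r I C -> closed_in r I D -> C :&: D = set0 ->
    C :|: D = I -> C = set0 \/ D = set0) ->
  indecomposable M.
Proof.
move=> I0 conn; split; first exact: model_nonzero.
move=> U V UV sUV.
have cI := closed_inI (model_closed U) (model_closed V).
have cU := closed_inU (model_closed U) (model_closed V).
have [| |/model_set0|/model_set0] := conn _ _ (model_closed U) (model_closed V).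
- have [N eN] := model_onto cI; rewrite -eN; apply/model_set0.
  apply/seteqP; split=> [x Nx|x ->]; last exact: submod0.
  have NU : (N `<=` U)%classic by apply/model_le; rewrite eN subsetIl.
  have NV : (N `<=` V)%classic by apply/model_le; rewrite eN subsetIr.
  by rewrite -UV; split; [apply: NU | apply: NV].
- have [N eN] := model_onto cU; rewrite -eN; apply/model_setT.
  apply/seteqP; split=> // x _.
  have UN : (U `<=` N)%classic by apply/model_le; rewrite eN subsetUl.
  have VN : (V `<=` N)%classic by apply/model_le; rewrite eN subsetUr.
  have [u [v [uU vV ->]]] := sUV x.
  by rewrite -[u]scale1r; apply: submodP; [apply: UN|apply: VN].
- by left.
- by right.
Qed.

(** The correspondence between submodules of [M/N] and submodules of [M] above [N]: a submodule of
    the factor is read off from its preimage, with [S N] deleted. *)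
Lemma model_quot N : exists S' : submodule (quotmod N) -> {set T},
  closed_set_model r (I :\: S N) S'.
Proof.
pose pre_set (A : submodule (quotmod N)) : set M := fun x => submod_set A (quotmod_proj N x).
have pre0 A : pre_set A 0.
  have -> : pre_set A 0 = submod_set A (quotmod_proj N 0) by [].
  by rewrite quotmod_proj0; exact: submod0.
have preP A a x y : pre_set A x -> pre_set A y -> pre_set A (a *: x + y).
  by rewrite /pre_set quotmod_projD quotmod_projZ; apply: submodP.
pose pre A := Submodule (@pre0 A) (@preP A).
have preN A : S N \subset S (pre A).
  apply/model_le => x Nx; rewrite /= /pre_set.
  have -> : quotmod_proj N x = quotmod_proj N 0.
    by apply/quotmod_projP; rewrite subr0.
  exact: pre0.
have cN := model_closed N.
exists (fun A => S (pre A) :\: S N); split.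
- move=> A; have cA := model_closed (pre A); split; first by rewrite setSD // model_sub.
  move=> x y; rewrite !inE => /andP[_ xA] /andP[-> yI] rxy /=.
  exact: cA.2 rxy.
- move=> A B; have -> : (A `<=` B)%classic <-> (pre A `<=` pre B)%classic.
    split=> AB x; first exact: AB.
    by rewrite -(quotmod_projK x); apply: AB.
  rewrite model_le; split=> [|sAB]; first exact: setSD.
  apply/subsetP => x xA; have [xN|xN] := boolP (x \in S N).
    exact: (subsetP (preN B)).
  by have /subsetP/(_ x) := sAB; rewrite !inE xN xA => /(_ isT).
- move=> C [sC cC].
  have cCN : closed_in r I (C :|: S N).
    split=> [|x y].
      by rewrite subUset model_sub andbT (subset_trans sC) ?subsetDl.
    rewrite !inE => /orP[xC|xN] yI rxy; last by rewrite (cN.2 x y) ?orbT.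
    have [yN|yN] := boolP (y \in S N); first by rewrite orbT.
    by rewrite (cC x y) // inE yN.
  have [W eW] := model_onto cCN.
  (* Since [W] contains [N], whether the chosen representative lies in [W] does not depend on the
     choice. *)
  pose im_set : set (quotmod N) := fun u => submod_set W (repr u).
  have NW : (N `<=` W)%classic by apply/model_le; rewrite eW subsetUr.
  have imE x : im_set (quotmod_proj N x) <-> submod_set W x.
    have /quotmod_projP/NW Wd := quotmod_projK (quotmod_proj N x).
    have WB y z : submod_set W y -> submod_set W z -> submod_set W (y - z).
      by move=> Wy Wz; rewrite addrC -scaleN1r; apply: submodP.
    rewrite /im_set; split=> [W1|W1].
      by have := WB _ _ W1 Wd; rewrite opprB addrCA subrr addr0.
    by have := @submodP _ _ W 1 _ _ Wd W1; rewrite scale1r subrK.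
  have im0 : im_set 0.
    by rewrite -quotmod_proj0; apply/imE; exact: submod0.
  have imP a x y : im_set x -> im_set y -> im_set (a *: x + y).
    rewrite -(quotmod_projK x) -(quotmod_projK y).
    have -> : a *: quotmod_proj N (repr x) = quotmod_proj N (a *: repr x).
      by rewrite quotmod_projZ.
    rewrite -quotmod_projD => /imE Wx /imE Wy; apply/imE; exact: submodP.
  exists (Submodule im0 imP).
  have -> : S (pre (Submodule im0 imP)) = S W.
    by apply/model_eq/seteqP; split=> x; rewrite /= /pre_set /= imE.
  rewrite eW; apply/setP => x; rewrite !inE.
  have [xN|xN] /= := boolP (x \in S N); last by rewrite orbF.
  by apply/esym/negbTE; apply: contraL xN => /(subsetP sC); rewrite inE => /andP[].
Qed.

End Model.

(** * Radical series and uniserial factors in terms of closed sets *)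

Section LoewySeries.
Variables (T : finType) (r : rel T) (h : T -> nat).
Hypothesis r_mono : forall x y, r x y -> (h x < h y)%N.
Variables (R : pzRingType) (M : lmodType R) (I : {set T}).
Variable S : submodule M -> {set T}.
Hypothesis model : closed_set_model r I S.

(** Working with the closed sets of [I] above [S N] keeps one ambient set for all the factors
    [M/rad^k M]. *)
Lemma model_uniserial_quot (N : submodule M) : uniserial (quotmod N) <->
  forall C D, closed_in r I C -> closed_in r I D -> S N \subset C -> S N \subset D ->
    #|C| = #|D| -> C = D.
Proof.
have [S' model'] := model_quot model N; rewrite (model_uniserial r_mono model').
have sN := model_sub model N; have cN := model_closed model N.
have cardE (C : {set T}) : S N \subset C -> #|C| = (#|S N| + #|C :\: S N|)%N.
  by move=> sNC; rewrite -[LHS](cardsID (S N)) (setIidPr sNC).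
split=> hN C D cC cD => [NC ND eCD|eCD].
  have closedD E : closed_in r I E -> closed_in r (I :\: S N) (E :\: S N).
    move=> [sE cE]; split=> [|x y]; first exact: setSD.
    by rewrite !inE => /andP[_ xE] /andP[-> yI]; exact: cE.
  have eD : C :\: S N = D :\: S N.
    apply: hN; try exact: closedD.
    by apply/eqP; rewrite -(eqn_add2l #|S N|) -!cardE // eCD.
  apply/setP=> x; have [xN|xN] := boolP (x \in S N).
    by rewrite (subsetP NC) // (subsetP ND).
  by have /setP/(_ x) := eD; rewrite !inE xN.
have closedU E : closed_in r (I :\: S N) E -> closed_in r I (S N :|: E).
  move=> [sE cE]; split=> [|x y].
    by rewrite subUset sN (subset_trans sE) ?subsetDl.
  rewrite !inE => /orP[xN|xE] yI rxy; first by rewrite (cN.2 x y).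
  have [yN|yN] //= := boolP (y \in S N).
  by apply: cE rxy => //; rewrite inE yN.
have disjE E : closed_in r (I :\: S N) E -> (S N :|: E) :\: S N = E.
  move=> [sE _]; apply/setP=> x; rewrite !inE; case: (boolP (x \in S N)) => //= xN.
  by apply/esym/negbTE; apply: contraL xN => /(subsetP sE); rewrite inE => /andP[].
have sNU E : S N \subset S N :|: E by exact: subsetUl.
rewrite -(disjE C) // -(disjE D) //; congr (_ :\: _).
apply: hN; try exact: closedU; try exact: sNU.
by rewrite (cardE (S N :|: C)) // (cardE (S N :|: D)) // !disjE // eCD.
Qed.

(** An element of minimal height outside [C] works: a predecessor of it in [J] lies in [C] by
    minimality, and closure would then put the element into [C]. *)
Lemma source_outside (J C : {set T}) : closed_in r J C -> C \proper J ->
  exists x, [/\ x \in J, x \notin C & ~~ [exists y in J, r y x]].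
Proof.
move=> [sC cC] /properP[_ [x0 x0J x0C]].
have P0 : x0 \in J :\: C by rewrite inE x0C x0J.
case: (arg_minnP h P0) => x /setDP[xJ xC] xmin; exists x; split=> //.
apply/existsP=> -[y /andP[yJ ryx]].
have [yC|yC] := boolP (y \in C); first by rewrite (cC y x) in xC.
have yD : y \in J :\: C by rewrite inE yC yJ.
by have := xmin y yD; rewrite /= leqNgt r_mono.
Qed.

Local Notation J k := (S (rad_iter M k)).

Lemma model_rad_iter0 : J 0 = I.
Proof. exact/(model_setT model). Qed.

Lemma model_rad_iter_sub k : J k.+1 \subset J k.
Proof. by apply/(model_le model) => x []. Qed.

Lemma model_rad_iter_card_lt k : J k != set0 -> (#|J k.+1| < #|J k|)%N.
Proof.
move=> n0.
have [x [xJ _ nx]] : exists x, [/\ x \in J k, x \notin set0 & ~~ [exists y in J k, r y x]].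
  by apply: source_outside; [exact: closed_in0 | rewrite proper0].
apply: proper_card; rewrite properE model_rad_iter_sub /=.
apply/subsetPn; exists x => //.
by rewrite (model_rad r_mono model) inE negb_and nx orbT.
Qed.

Lemma model_rad_iter_card k : (#|J k| <= #|I| - k)%N.
Proof.
elim: k => [|k IHk]; first by rewrite subn0 subset_leq_card // (model_sub model).
have [e|n0] := eqVneq (J k) set0.
  by have := model_rad_iter_sub k; rewrite e subset0 => /eqP->; rewrite cards0.
have lt := leq_trans (model_rad_iter_card_lt n0) IHk.
by rewrite subnS -ltnS (leq_trans lt) // leqSpred.
Qed.

(** For [m >= 2] factor seriality looks at [rad^(l-m+1)], hence never past [rad^(l-1)]; this
    guarantees that a nonuniserial module is detected by then. If [rad^(l-1)] is zero, the factor is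
    the module itself. Otherwise the radical series is too long to allow more than one source in
    each layer. *)
Lemma uniserial_last_rad :
  uniserial (quotmod (rad_iter M (#|I| - 1))) -> uniserial M.
Proof.
have [I0|I0] := posnP #|I|.
  move=> _; apply/(model_uniserial r_mono model) => C D [sC _] [sD _] _.
  by move: sC sD; rewrite (cards0_eq I0) !subset0 => /eqP-> /eqP->.
move/model_uniserial_quot => uI; apply/(model_uniserial r_mono model).
have [J0|Jn0] := eqVneq (J (#|I| - 1)) set0.
  by move=> C D cC cD; apply: uI; rewrite // J0 sub0set.
(* Each step of the radical series loses at least one element; being nonempty after [#|I| - 1] steps
   leaves room for exactly one each time. *)
have cardJ k : (k < #|I|)%N -> #|J k| = (#|I| - k)%N.
  move=> kI; apply/eqP; rewrite eqn_leq model_rad_iter_card /=.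
  have [m em] : exists m, (#|I| - 1 = k + m)%N.
    by exists (#|I| - 1 - k)%N; rewrite subnKC // subn1 -ltnS prednK.
  have -> : (#|I| - k)%N = m.+1.
    by rewrite -(prednK I0) -subn1 em subSn ?leq_addr // addKn.
  move: Jn0; rewrite em; elim: m {em} k {kI} => [|m IHm] k.
    by rewrite addn0 card_gt0.
  rewrite addnS -addSn => /IHm lt; apply: (leq_ltn_trans lt).
  apply: model_rad_iter_card_lt; rewrite -card_gt0.
  by apply: leq_trans (subset_leq_card (model_rad_iter_sub k)); apply: leq_trans lt.
(* A closed set smaller than [J k] misses one of its sources. As [J k.+1] is [J k] without exactly
   that source, the closed set stays inside. *)
have small k C : (k < #|I|)%N -> closed_in r I C -> (#|C| <= #|I| - k)%N -> C \subset J k.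
  elim: k => [|k IHk] kI cC leC; first by rewrite model_rad_iter0 cC.1.
  have kI' := ltnW kI.
  have ltC : (#|C| < #|J k|)%N by rewrite cardJ // (leq_ltn_trans leC) // ltn_sub2l.
  have sC : C \subset J k by apply: IHk => //; rewrite -cardJ // ltnW.
  have cCJ : closed_in r (J k) C.
    split=> // x y xC yJ; apply: cC.2 => //.
    exact: subsetP (model_sub model _) _ yJ.
  have [|x [xJ xC nx]] := source_outside cCJ; first by rewrite properEcard sC.
  have eJ : J k.+1 = J k :\ x.
    apply/eqP; rewrite eqEcard; apply/andP; split.
      apply/subsetP=> y yJ; rewrite !inE (subsetP (model_rad_iter_sub k)) // andbT.
      apply: contraTneq yJ => ->.
      by rewrite (model_rad r_mono model) inE negb_and nx orbT.
    have := cardsD1 x (J k); rewrite xJ !cardJ // subnS add1n => ->.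
    by rewrite /= leqnn.
  by rewrite eJ subsetD1 sC xC.
have uniq k C : (k < #|I|)%N -> closed_in r I C -> #|C| = (#|I| - k)%N -> C = J k.
  by move=> kI cC eC; apply/eqP; rewrite eqEcard cardJ // eC leqnn andbT small ?eC.
move=> C D cC cD eCD; have [D0|D0] := posnP #|D|.
  by rewrite (cards0_eq D0) (cards0_eq (etrans eCD D0)).
have kI : (#|I| - #|D| < #|I|)%N by rewrite -subn_gt0 subKn // subset_leq_card // cD.1.
have ek : (#|I| - (#|I| - #|D|))%N = #|D| by rewrite subKn // subset_leq_card // cD.1.
by rewrite (uniq _ C kI cC) ?ek // -(uniq _ D kI cD) ?ek.
Qed.

(** For nonuniserial [M] of length [l], let [k] be least such that [M/rad^(k+1)] is not uniserial;
    then [m] is [l - k]. If [M/rad M] is uniserial, [k] is positive: this is where the bound drops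
    by one in case (a). *)
Lemma model_factor_serial : I != set0 ->
  exists i, [/\ (0 < i <= #|I|)%N, factor_serial M i &
    uniserial (quotmod (rad_iter M 1)) -> i = 1%N \/ (i < #|I|)%N].
Proof.
move=> I0; have nzM := model_nonzero model I0.
have lM := model_length r_mono model.
have cI0 : (0 < #|I|)%N by rewrite card_gt0.
have [uM|nuM] := pselect (uniserial M).
  by exists 1%N; split; [by [] | split=> //; exists #|I|; split=> //; left | left].
have uI0 : uniserial (quotmod (rad_iter M 0)).
  apply/model_uniserial_quot => C D [sC _] [sD _].
  rewrite model_rad_iter0 => IC ID _; apply/eqP.
  by rewrite eqEsubset (subset_trans sC ID) (subset_trans sD IC).
have I1 : (1 < #|I|)%N.
  rewrite ltnNge; apply/negP => I1; apply: nuM; apply: uniserial_last_rad.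
  by have -> // : (#|I| - 1 = 0)%N by apply/eqP; rewrite subn_eq0.
(* The index [l - 2] is a candidate for [k], so the least one satisfies [k <= l - 2], which gives
   [m >= 2]. *)
have nul : ~~ `[< uniserial (quotmod (rad_iter M (#|I| - 2).+1)) >].
  apply/asboolPn => u; apply: nuM; apply: uniserial_last_rad.
  by rewrite -subSn in u.
have ex_nu : exists k, ~~ `[< uniserial (quotmod (rad_iter M k.+1)) >].
  by exists (#|I| - 2)%N.
case: (ex_minnP ex_nu) => k /asboolPn nuk mink.
have kI : (k.+1 < #|I|)%N.
  by have := mink _ nul; rewrite leq_subRL // addnC addn2.
have uk : uniserial (quotmod (rad_iter M k)).
  case: k nuk mink {kI} => // k nuk mink; apply: contrapT => /asboolPn /mink.
  by rewrite ltnn.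
exists (#|I| - k)%N; split.
- by rewrite leq_subr subn_gt0 ltnW.
- split=> //; exists #|I|; split=> //; right.
  have ek : (#|I| - (#|I| - k) = k)%N by rewrite subKn // ltnW // ltnW.
  by rewrite ek addn1; split; rewrite // leq_subr andbT ltn_subRL addn1.
- case: k uk nuk {kI mink} => [_ //|k _ _ _]; right.
  by rewrite ltn_subrL.
Qed.

End LoewySeries.

(** * Filtrations and linear relations *)

Lemma submodZ (R : pzRingType) (V : lmodType R) (N : submodule V) a x :
  submod_set N x -> submod_set N (a *: x).
Proof. by move=> Nx; rewrite -[_ *: _]addr0; apply: submodP => //; exact: submod0. Qed.

Lemma submodD (R : pzRingType) (V : lmodType R) (N : submodule V) x y :
  submod_set N x -> submod_set N y -> submod_set N (x + y).
Proof. by move=> Nx Ny; rewrite -[x]scale1r; apply: submodP. Qed.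

Lemma submod_sum (R : pzRingType) (V : lmodType R) (N : submodule V)
    (J : Type) (s : seq J) (P : pred J) (F : J -> V) :
  (forall j, P j -> submod_set N (F j)) -> submod_set N (\sum_(j <- s | P j) F j).
Proof.
by move=> NF; apply: big_ind => //; [exact: submod0 | move=> x y; exact: submodD].
Qed.

Section Functionals.
Variables (K : fieldType) (V : lmodType K).

(** A subspace maximal among those that contain [N] and avoid [a] is a complement of the line
    through [a]; [phi] is the coordinate along [a]. *)
Lemma separating_functional (N : submodule V) (a : V) : ~ submod_set N a ->
  exists phi : {scalar V}, phi a = 1 /\ forall x, submod_set N x -> phi x = 0.
Proof.
move=> Na.
(* [P] allows the empty set, which is the union of the empty chain. *)
pose P (A : set V) := [/\ forall (c : K) x y, A x -> A y -> A (c *: x + y),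
  forall x y, A x -> submod_set N y -> A (x + y) & ~ A a].
have [|A [[lA NA nAa] maxA]] := @Zorn_bigcup V P.
  move=> F FP totF; split=> [c x y [A FA Ax] [B FB By]|x y [A FA Ax] Ny|[A FA]].
  - have [AB|BA] := totF _ _ FA FB.
      by exists B => //; have [lB _ _] := FP _ FB; apply: lB => //; apply: AB.
    by exists A => //; have [lA _ _] := FP _ FA; apply: lA => //; apply: BA.
  - by exists A => //; have [_ NA _] := FP _ FA; exact: NA.
  - by have [_ _] := FP _ FA.
have PN : P N.
  by split=> // [c x y|x y]; [exact: submodP | exact: submodD].
have A0 : A 0.
  have [x Ax] : exists x, A x.
    apply: contrapT => nA; apply: (maxA N) => //; split=> [x Ax|/(_ 0) NA0].
      by case: nA; exists x.
    by apply: nA; exists 0; apply: NA0; exact: submod0.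
  by have := lA (-1) _ _ Ax Ax; rewrite scaleN1r addNr.
have AZ c x : A x -> A (c *: x) by move=> Ax; rewrite -[_ *: _]addr0; exact: lA.
have AB x y : A x -> A y -> A (x - y).
  by move=> Ax Ay; rewrite addrC -scaleN1r; exact: lA.
have dec x : exists c : K, A (x - c *: a).
  have [Ax|nAx] := pselect (A x); first by exists 0; rewrite scale0r subr0.
  (* [B] is the span of [A] and [x]. Maximality of [A] forces [a] into it, and solving for [x] gives
     the coordinate of [x]. *)
  pose B : set V := fun y => exists d z, A z /\ y = z + d *: x.
  have nPB : ~ P B.
    apply: maxA; split=> [z Az|]; first by exists 0, z; rewrite scale0r addr0.
    by move=> /(_ x) BA; apply/nAx/BA; exists 1, 0; rewrite scale1r add0r.
  have Ba : B a.
    apply: contrapT => nBa; apply: nPB; split=> //.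
    - move=> c y z [d [y' [Ay' ->]]] [e [z' [Az' ->]]].
      exists (c * d + e), (c *: y' + z'); split; first exact: lA.
      by rewrite scalerDr scalerDl scalerA addrACA.
    - move=> y z [d [y' [Ay' ->]]] Nz; exists d, (y' + z); split; first exact: NA.
      by rewrite addrAC.
  have [d [z [Az ea]]] := Ba.
  have d0 : d != 0.
    by apply: contra_notN nAa => /eqP d0; rewrite ea d0 scale0r addr0.
  exists d^-1; rewrite ea scalerDr scalerA mulVf // scale1r opprD addrCA subrr addr0.
  by rewrite -scalerN -[- z]add0r; apply: AZ; apply: AB.
have /choice[phi phiP] := dec.
have uniq x c : A (x - c *: a) -> phi x = c.
  move=> Ac; apply: contra_notP nAa => /eqP; rewrite -subr_eq0 => nz.
  have := AB _ _ Ac (phiP x).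
  have -> : x - c *: a - (x - phi x *: a) = (phi x - c) *: a.
    by rewrite scalerBl opprB addrC addrA subrK.
  by move=> /(AZ (phi x - c)^-1); rewrite scalerA mulVf // scale1r.
have lin : scalar phi.
  move=> c x y; apply: uniq; rewrite scalerDl opprD addrACA -scalerA -scalerBr.
  exact: lA.
pose phiL : {scalar V} := HB.pack phi (GRing.isLinear.Build K V K *%R phi lin).
exists phiL; split=> [|x Nx]; apply: uniq; first by rewrite scale1r subrr.
by rewrite scale0r subr0 -[x]add0r; exact: NA.
Qed.

End Functionals.

Section LinearRelations.
Variables (K : fieldType) (V : lmodType K).
Implicit Types (U W : submodule V) (a x y : V) (phi : {scalar V}).

(* Linear relations treat arrows [U -> W] and [W -> U] uniformly, as graphs. *)
Record linear_relation U W (rho : V -> V -> Prop) : Prop := LinearRelation {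
  linrel_dom : forall x y, rho x y -> submod_set U x;
  linrel_cod : forall x y, rho x y -> submod_set W y;
  linrel0 : rho 0 0;
  linrelP : forall (c : K) x y x' y', rho x y -> rho x' y' -> rho (c *: x + x') (c *: y + y')
}.

Definition preimage_set (rho : V -> V -> Prop) (W : submodule V) : set V :=
  fun x => exists y, submod_set W y /\ rho x y.

Section Preimage.
Variables (U W : submodule V) (rho : V -> V -> Prop).
Hypothesis rhoP : linear_relation U W rho.

Lemma preimage_set0 (N : submodule V) : preimage_set rho N 0.
Proof. by exists 0; split; [exact: submod0 | exact: linrel0 rhoP]. Qed.

Lemma preimage_setP (N : submodule V) (c : K) x y :
  preimage_set rho N x -> preimage_set rho N y -> preimage_set rho N (c *: x + y).
Proof.
move=> [x' [Nx' rx]] [y' [Ny' ry]]; exists (c *: x' + y'); split.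
  exact: submodP.
exact: linrelP rhoP _ _ _ _ _ rx ry.
Qed.

Definition preimage N : submodule V :=
  Submodule (preimage_set0 N) (preimage_setP (N := N)).

End Preimage.

Definition zero_submod : submodule V.
Proof.
exists [set 0]%classic => // c x y -> ->.
by rewrite scaler0 addr0.
Defined.

(* [a] spans, and [phi] cuts out a complement of, a line compatible with the
   filtration [F]. *)
Definition compatible (F : nat -> submodule V) a phi : Prop :=
  phi a = 1 /\ forall i, submod_set (F i) a \/ forall x, submod_set (F i) x -> phi x = 0.

Definition filtration W (F : nat -> submodule V) (L : nat) : Prop :=
  [/\ forall x, submod_set (F 0%N) x -> x = 0,
      forall i j x, (i <= j)%N -> submod_set (F i) x -> submod_set (F j) x,
      forall i x, submod_set (F i) x -> submod_set W x &
      forall x, submod_set W x -> submod_set (F L) x].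

(** The two exits are the ways in which a line splits off without reaching the next vertex. For an
    arrow leaving [U], [rho a 0] says that the arrow kills [a]; for an arrow entering [U], the
    second exit says that its image lies in the complement cut out by [phi]. *)
Lemma extend_line U W rho (F : nat -> submodule V) L a phi :
  linear_relation U W rho -> filtration W F L ->
  phi a = 1 ->
  (forall i, preimage_set rho (F i) a \/ forall x, preimage_set rho (F i) x -> phi x = 0) ->
  [\/ rho a 0, forall x y, rho x y -> phi x = 0 |
      exists b psi, [/\ submod_set W b, compatible F b psi, rho a b &
        forall x y, rho x y -> psi y = phi x]].
Proof.
move=> rhoP [F0 Fmono FW FL] phia Fa.
have [ker|nker] := pselect (preimage_set rho (F 0%N) a).
  by have [y [/F0 ->]] := ker; constructor 1.
have [dom|ndom] := pselect (preimage_set rho (F L) a); last first.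
  constructor 2 => x y rxy; have [//|] := Fa L.
  apply; exists y; split=> //; apply: FL; exact: linrel_cod rhoP _ _ rxy.
constructor 3.
(* [b] is taken in the earliest step of [F] that is related to [a], so that all earlier steps can be
   put into the kernel of [psi]. *)
have ex_m : exists m, `[< preimage_set rho (F m) a >] by exists L; apply/asboolP.
case: (ex_minnP ex_m) => m /asboolP[b [Fb rab]] minm.
case: m => [|m] in Fb minm; first by case: nker; exists b.
have nFm : ~ preimage_set rho (F m) a.
  by move=> /asboolP/minm; rewrite ltnn.
have phim x : preimage_set rho (F m) x -> phi x = 0.
  by have [/nFm //|] := Fa m; apply.
(* [rho (ker phi) + F m] has to lie in the kernel of the new functional. *)
pose B_set : set V := fun y => exists x y' u,
  [/\ rho x y', phi x = 0, submod_set (F m) u & y = y' + u].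
have B0 : B_set 0.
  exists 0, 0, 0; split; rewrite ?addr0 ?linear0 //; first exact: linrel0 rhoP.
  exact: submod0.
have BP (c : K) x y : B_set x -> B_set y -> B_set (c *: x + y).
  move=> [x1 [x2 [x3 [r1 p1 f1 ->]]]] [y1 [y2 [y3 [r2 p2 f2 ->]]]].
  exists (c *: x1 + y1), (c *: x2 + y2), (c *: x3 + y3); split.
  - exact: linrelP rhoP _ _ _ _ _ r1 r2.
  - by rewrite linearP p1 p2 /= mulr0 addr0.
  - exact: submodP.
  - by rewrite scalerDr addrACA.
have rhoB x y x' y' : rho x y -> rho x' y' -> rho (x - x') (y - y').
  move=> r1 r2; have := linrelP rhoP (-1) r2 r1.
  by rewrite !scaleN1r ![- _ + _]addrC.
have nBb : ~ submod_set (Submodule B0 BP) b.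
  move=> [x [y [u [rxy px Fu eb]]]].
  have : phi (a - x) = 0.
    apply: phim; exists u; split=> //.
    by have := rhoB _ _ _ _ rab rxy; rewrite eb [y + u]addrC addrK.
  by rewrite linearB phia px /= subr0 => /eqP; rewrite oner_eq0.
have [psi [psib psiB]] := separating_functional nBb.
(* [y - phi x *: b] is related to [x - phi x *: a], which lies in the kernel of [phi]; so it belongs
   to the subspace killed by [psi]. *)
have psirho x y : rho x y -> psi y = phi x.
  move=> rxy; have /eqP : psi (y - phi x *: b) = 0.
    apply: psiB; exists (x - phi x *: a), (y - phi x *: b), 0; split.
    - apply: rhoB => //; have := linrelP rhoP (phi x) rab (linrel0 rhoP).
      by rewrite !addr0.
    - by rewrite linearB linearZ phia /= mulr1 subrr.
    - exact: submod0.
    - by rewrite addr0.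
  by rewrite linearB linearZ psib /= mulr1 subr_eq0 => /eqP.
exists b, psi; split=> //; first exact: FW Fb.
split=> // i; have [mi|im] := ltnP m i; first by left; exact: Fmono Fb.
right=> x Fx; apply: psiB; exists 0, 0, x; split; rewrite ?linear0 ?add0r //.
  exact: linrel0 rhoP.
exact: Fmono Fx.
Qed.

(** The filtration depends only on the relations and is fixed before any line is chosen. This order
    of quantifiers lets the induction peel off the leftmost relation: the filtration for the others
    is pulled back, and a compatible line is passed on by [extend_line]. *)
Lemma extend_thin t (W : nat -> submodule V) (rho : nat -> V -> V -> Prop) :
  (forall k, (k < t)%N -> linear_relation (W k) (W k.+1) (rho k)) ->
  exists F L, filtration (W 0%N) F L /\
    forall a phi, submod_set (W 0%N) a -> compatible F a phi ->
    exists r (b : nat -> V) (psi : nat -> {scalar V}),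
      [/\ (r <= t)%N, b 0%N = a /\ psi 0%N = phi,
          forall j, (j <= r)%N -> submod_set (W j) (b j) /\ psi j (b j) = 1,
          forall j, (j < r)%N -> rho j (b j) (b j.+1) /\
            forall x y, rho j x y -> psi j.+1 y = psi j x &
          (r < t)%N -> rho r (b r) 0 \/ forall x y, rho r x y -> psi r x = 0].
Proof.
elim: t W rho => [|t IHt] W rho rhoP.
  exists (fun i => if i is 0%N then zero_submod else W 0%N), 1%N.
  split=> [|a phi Wa [phia _]].
    split=> //.
    - by case=> [|i] [|j] x //= _ ->; exact: submod0.
    - by case=> [|i] x //= ->; exact: submod0.
  exists 0%N, (fun=> a), (fun=> phi); split=> // j.
  by rewrite leqn0 => /eqP->.
have [|F [L [fF extF]]] := IHt (fun k => W k.+1) (fun k => rho k.+1).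
  by move=> k; exact: rhoP k.+1.
have rho0P := rhoP 0%N isT.
have [F0 Fmono FW FL] := fF.
(* Indices 1 to [L.+1] are the pullbacks of [F 0] to [F L], and later ones are all of [W 0]. Both
   ends are added because the pullback of zero may be nonzero, as the kernel of an arrow, and the
   domain of [rho 0] may be smaller than [W 0], as the image of an arrow. *)
pose G i := if i is i'.+1 then if (i' <= L)%N then preimage rho0P (F i') else W 0%N
            else zero_submod.
exists G, L.+2; split.
  split=> //.
  - case=> [|i] [|j] x //=; first by move=> _ ->; exact: submod0.
    rewrite ltnS => ij; case: (leqP j L) => jL; first rewrite (leq_trans ij jL).
      by move=> [y [Fy rxy]]; exists y; split=> //; exact: Fmono Fy.
    case: leqP => // _ [y [Fy rxy]]; exact: linrel_dom rho0P _ _ rxy.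
  - case=> [|i] x /=; first by move=> ->; exact: submod0.
    case: leqP => // _ [y [Fy rxy]]; exact: linrel_dom rho0P _ _ rxy.
  - by move=> x; rewrite /= ltnn.
move=> a phi Wa [phia comp].
(* Past [L] the filtration [F] is constant, so the alternative at [L] decides. *)
have comp' i : preimage_set (rho 0%N) (F i) a \/
    forall x, preimage_set (rho 0%N) (F i) x -> phi x = 0.
  have [iL|Li] := leqP i L; first by have := comp i.+1; rewrite /= iL.
  have [[y [Fy ray]]|FLphi] : preimage_set (rho 0%N) (F L) a \/
      forall x, preimage_set (rho 0%N) (F L) x -> phi x = 0.
    by have := comp L.+1; rewrite /= leqnn.
  - by left; exists y; split=> //; exact: Fmono (ltnW Li) Fy.
  - right=> x [y [Fy rxy]]; apply: FLphi; exists y; split=> //.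
    by apply/FL/FW/Fy.
have [ra0|phi0|[b [psi [Wb compb rab psirho]]]] := extend_line rho0P fF phia comp'.
- exists 0%N, (fun=> a), (fun=> phi); split=> // [j|_]; last by left.
  by rewrite leqn0 => /eqP->.
- exists 0%N, (fun=> a), (fun=> phi); split=> // [j|_]; last by right.
  by rewrite leqn0 => /eqP->.
have [s [c [chi [st [c0 chi0] cW cr cs]]]] := extF _ _ Wb compb.
exists s.+1, (fun i => if i is j.+1 then c j else a).
exists (fun i => if i is j.+1 then chi j else phi); split=> //.
- by case=> [|j] //; exact: cW.
- by case=> [|j] //; [rewrite c0 chi0 | exact: cr].
Qed.

Lemma compatible_exists W (F : nat -> submodule V) L : filtration W F L ->
  (exists x, submod_set W x /\ x <> 0) ->
  exists a phi, submod_set W a /\ compatible F a phi.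
Proof.
move=> [F0 Fmono FW FL] [x [Wx nx]].
have ex_m : exists m, `[< exists y, submod_set (F m) y /\ y <> 0 >].
  by exists L; apply/asboolP; exists x; split=> //; exact: FL.
case: (ex_minnP ex_m) => m /asboolP[a [Fa na]] minm.
have [phi [phia _]] := @separating_functional _ _ zero_submod a na.
exists a, phi; split; first exact: FW Fa.
split=> // i; have [mi|im] := leqP m i; first by left; exact: Fmono Fa.
right=> y Fy; have -> : y = 0; last exact: linear0.
apply: contrapT => ny; have : (m <= i)%N by apply: minm; apply/asboolP; exists y.
by rewrite leqNgt im.
Qed.

Lemma thin_line_exists t (W : nat -> submodule V) (rho : nat -> V -> V -> Prop) :
  (forall k, (k < t)%N -> linear_relation (W k) (W k.+1) (rho k)) ->
  (exists x, submod_set (W 0%N) x /\ x <> 0) ->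
  exists r (b : nat -> V) (psi : nat -> {scalar V}),
    [/\ (r <= t)%N,
        forall j, (j <= r)%N -> submod_set (W j) (b j) /\ psi j (b j) = 1,
        forall j, (j < r)%N -> rho j (b j) (b j.+1) /\
          forall x y, rho j x y -> psi j.+1 y = psi j x &
        (r < t)%N -> rho r (b r) 0 \/ forall x y, rho r x y -> psi r x = 0].
Proof.
move=> rhoP W0; have [F [L [fF extF]]] := extend_thin rhoP.
have [a [phi [Wa comp]]] := compatible_exists fF W0.
by have [r [b [psi [? _ ? ? ?]]]] := extF _ _ Wa comp; exists r, b, psi.
Qed.

End LinearRelations.

(** * Right modules over the path algebra *)

Definition arrow_path (Q : quiver) (al : Q1 Q) : qpath Q :=
  @QPath Q (src al, [:: al]) (introT andP (conj (eqxx (src al)) isT)).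

(* Locked, since unification would otherwise unfold these elements down to
   finite maps. *)
HB.lock Definition vertex_elt (K : fieldType) (Q : quiver) (a : Q0 Q) : pathalg K Q :=
  << ptriv a >>.
HB.lock Definition arrow_elt (K : fieldType) (Q : quiver) (al : Q1 Q) : pathalg K Q :=
  << arrow_path al >>.

Arguments vertex_elt K {Q} a.
Arguments arrow_elt K {Q} al.

Section PathAlgebraGenerators.
Variables (K : fieldType) (Q : quiver).
Local Notation A := (pathalg K Q).
Implicit Types (a b : Q0 Q) (al : Q1 Q).
Local Notation vertex_elt := (vertex_elt K).
Local Notation arrow_elt := (arrow_elt K).

Lemma mul_basis (p q : qpath Q) :
  (<< p >> : A) * << q >> = basis_opt 1 (path_comp p q).
Proof. by rewrite -[1 in RHS]mul1r -pathalg_mulUU. Qed.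

Lemma scale_basis (c : K) (p : qpath Q) : c *: (<< p >> : A) = << c *g p >>.
Proof.
apply/malgP => q; apply: etrans (esym (mcoeffU p c q)).
by rewrite (@mcoeffZ (qpath Q) K) [in LHS](mcoeffU p 1 q) mulrnAr mulr1.
Qed.

Lemma vertex_eltM a b : vertex_elt a * vertex_elt b = if a == b then vertex_elt a else 0.
Proof.
by rewrite vertex_elt.unlock mul_basis path_comp_triv_l /=; case: eqP => [->|].
Qed.

Lemma vertex_arrow a al :
  vertex_elt a * arrow_elt al = if a == src al then arrow_elt al else 0.
Proof.
rewrite vertex_elt.unlock arrow_elt.unlock mul_basis path_comp_triv_l /=.
by case: eqP.
Qed.

Lemma arrow_vertex al a :
  arrow_elt al * vertex_elt a = if a == tgt al then arrow_elt al else 0.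
Proof.
rewrite vertex_elt.unlock arrow_elt.unlock mul_basis path_comp_triv_r /=.
by case: eqP.
Qed.

Lemma sum_vertex_elt : \sum_(a : Q0 Q) vertex_elt a = 1 :> A.
Proof. by apply: eq_bigr => a _; rewrite vertex_elt.unlock. Qed.

Lemma path_elt_ind (P : A -> Prop) :
  (forall a, P (vertex_elt a)) ->
  (forall al x, P x -> P (arrow_elt al * x)) -> forall p : qpath Q, P << p >>.
Proof.
move=> Pv Pa [[a s] hs]; elim: s a hs => [|al s IHs] a hs.
  have -> : QPath hs = ptriv a by apply: qpath_eq.
  by have := Pv a; rewrite vertex_elt.unlock.
have /andP[/= /eqP ea hs'] := hs.
have -> : (<< QPath hs >> : A) = arrow_elt al * << @QPath Q (tgt al, s) hs' >>.
  rewrite arrow_elt.unlock mul_basis.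
  have [|u [-> u1 _ u3]] := @path_compP Q (arrow_path al) (@QPath Q (tgt al, s) hs').
    by [].
  rewrite /=; congr (<< _ >>); apply: qpath_eq; first by rewrite u1 /pstart /= ea.
  by rewrite u3.
exact: Pa.
Qed.

End PathAlgebraGenerators.

Section RightModules.
Variables (K : fieldType) (Q : quiver) (M : rmodType (pathalg K Q)).
Local Notation A := (pathalg K Q).
Implicit Types (a b : Q0 Q) (al : Q1 Q) (x y : M) (c : K).

Definition ract x (u : A) : M := (u : A^c) *: x.

Lemma ractM x u v : ract (ract x u) v = ract x (u * v).
Proof. by rewrite /ract scalerA. Qed.

Lemma ract1 x : ract x 1 = x.
Proof. exact: scale1r. Qed.

Lemma ract0r x : ract x 0 = 0.
Proof. exact: scale0r. Qed.

Lemma ractDl x y u : ract (x + y) u = ract x u + ract y u.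
Proof. exact: scalerDr. Qed.

Lemma ract0l u : ract 0 u = 0.
Proof. exact: scaler0. Qed.

Lemma ract_sumr x (J : Type) (s : seq J) (P : pred J) (F : J -> A) :
  ract x (\sum_(j <- s | P j) F j) = \sum_(j <- s | P j) ract x (F j).
Proof. by rewrite /ract scaler_suml. Qed.

Lemma ract_suml u (J : Type) (s : seq J) (P : pred J) (F : J -> M) :
  ract (\sum_(j <- s | P j) F j) u = \sum_(j <- s | P j) ract (F j) u.
Proof. by rewrite /ract scaler_sumr. Qed.

(** An alias of [M], so that the [K]-structure through the elements [c *: 1] can coexist with the
    structure over the converse of the path algebra. *)
Definition restrict_scalars : Type := M.
HB.instance Definition _ := GRing.Zmodule.on restrict_scalars.

Definition kscale c (x : restrict_scalars) : restrict_scalars :=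
  ract x (c *: (1 : A)).

Lemma scale_one_mul c (u : A) : c *: (1 : A) * u = c *: u.
Proof. by rewrite -pathalg_scalerAl mul1r. Qed.

Lemma mul_scale_one c (u : A) : u * (c *: (1 : A)) = c *: u.
Proof. by rewrite -pathalg_scalerAr mulr1. Qed.

Lemma kscaleA c d x : kscale c (kscale d x) = kscale (c * d) x.
Proof. by rewrite /kscale ractM scale_one_mul scalerA mulrC. Qed.

Lemma kscale1 : left_id 1 kscale.
Proof. by move=> x; rewrite /kscale scale1r ract1. Qed.

Lemma kscaleDr : right_distributive kscale +%R.
Proof. by move=> c x y; exact: ractDl. Qed.

Lemma kscaleDl x : {morph kscale^~ x : c d / c + d}.
Proof. by move=> c d; rewrite /kscale scalerDl /ract scalerDl. Qed.

HB.instance Definition _ := GRing.Zmodule_isLmodule.Build K restrict_scalars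
  kscaleA kscale1 kscaleDr kscaleDl.

Local Notation V := restrict_scalars.

Lemma kscaleE c (x : V) : c *: x = ract x (c *: (1 : A)).
Proof. by []. Qed.

Lemma ract_scale c (x : V) (u : A) : ract (c *: x : V) u = c *: (ract x u : V) :> V.
Proof. by rewrite !kscaleE !ractM scale_one_mul mul_scale_one. Qed.

Lemma ract_scaler c (x : V) (u : A) : ract x (c *: u) = c *: (ract x u : V) :> V.
Proof. by rewrite kscaleE ractM mul_scale_one. Qed.

Lemma ract_closed (N : submodule V) :
  (forall a x, submod_set N x -> submod_set N (ract x (vertex_elt K a))) ->
  (forall al x, submod_set N x -> submod_set N (ract x (arrow_elt K al))) ->
  forall x u, submod_set N x -> submod_set N (ract x u).
Proof.
move=> Nv Na x u Nx; rewrite (monalgE u) ract_sumr; apply: submod_sum => p _.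
rewrite -scale_basis ract_scaler; apply: submodZ; move: x Nx.
apply: (@path_elt_ind K Q (fun v => forall x, submod_set N x -> submod_set N (ract x v))).
  by move=> a x; exact: Nv.
by move=> al v IHv x Nx; rewrite -ractM; apply/IHv/Na.
Qed.

Definition ract_submodule (N : submodule V)
  (Nv : forall a x, submod_set N x -> submod_set N (ract x (vertex_elt K a)))
  (Na : forall al x, submod_set N x -> submod_set N (ract x (arrow_elt K al))) :
  submodule M.
Proof.
apply: (@Submodule A^c M (@submod_set K V N)); first exact: (@submod0 K V N).
move=> u x y Nx Ny; exact: (@submodD K V N _ _ (ract_closed Nv Na u Nx) Ny).
Defined.

Definition arrow_rel : rel (Q0 Q) :=
  fun a b => [exists al : Q1 Q, (src al == a) && (tgt al == b)].

(* Arrows leaving [I] need no condition: they end in zero vertex spaces. *)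
Definition thin_family (I : {set Q0 Q}) (b : Q0 Q -> V) : Prop :=
  [/\ forall j, j \in I -> ract (b j) (vertex_elt K j) = b j /\ b j <> 0,
      forall j x, j \in I -> exists c : K, ract x (vertex_elt K j) = c *: b j :> V,
      forall j x, j \notin I -> ract x (vertex_elt K j) = 0 &
      forall al, src al \in I -> tgt al \in I ->
        ract (b (src al)) (arrow_elt K al) = b (tgt al)].

Lemma ract_vertex_sum x : x = \sum_a ract x (vertex_elt K a).
Proof. by rewrite -ract_sumr sum_vertex_elt ract1. Qed.

(** The vertex idempotents cut every element into multiples of the [b j], so a submodule is
    determined by the [b j] it contains. Conversely, a closed [C] yields the elements whose
    components off [C] vanish. *)
Lemma thin_family_model I (b : Q0 Q -> V) : thin_family I b ->
  exists S : submodule M -> {set Q0 Q}, closed_set_model arrow_rel I S.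
Proof.
move=> [bI bv b0 ba]; pose S (N : submodule M) := [set j in I | `[< submod_set N (b j) >]].
have inS N j : j \in S N <-> j \in I /\ submod_set N (b j).
  by rewrite inE; split=> [/andP[? /asboolP]|[-> /asboolP]].
have Nract (N : submodule M) x u : submod_set N x -> submod_set N (ract x u).
  exact: submodZ.
exists S; split.
- move=> N; split; first by apply/subsetP=> j /inS[].
  move=> i j /inS[iI Ni] jI /existsP[al /andP[/eqP ei /eqP ej]].
  by apply/inS; split=> //; rewrite -ej -ba ?ei ?ej //; apply: Nract.
- move=> N N'; split=> [NN'|/subsetP sNN' x Nx].
    by apply/subsetP=> j /inS[jI Nj]; apply/inS; split=> //; exact: NN'.
  rewrite (ract_vertex_sum x); apply: submod_sum => j _.
  have [jI|jI] := boolP (j \in I); last by rewrite b0 //; exact: submod0.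
  have [c ec] := bv _ x jI; have [c0|c0] := eqVneq c 0.
    by rewrite ec c0 scale0r; exact: submod0.
  have Nb : submod_set N (b j).
    have e : c^-1 *: (c *: b j : V) = b j.
      by rewrite (@scalerA K V) (mulVf c0) (@scale1r K V).
    rewrite -ec in e; rewrite -e.
    exact: (Nract N _ (c^-1 *: (1 : A)) (Nract N _ _ Nx)).
  have /inS[_ N'b] : j \in S N' by apply: sNN'; apply/inS.
  by rewrite ec; apply: Nract.
- move=> C [/subsetP sC cC].
  pose N_set : set V := fun x => forall j, j \notin C -> ract x (vertex_elt K j) = 0.
  have N0 : N_set 0 by move=> j _; exact: ract0l.
  have NP (c : K) (x y : V) : N_set x -> N_set y -> N_set (c *: x + y).
    move=> Nx Ny j jC; rewrite ractDl Ny // addr0 ract_scale Nx //.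
    exact: scaler0.
  pose N := Submodule N0 NP.
  have Nv a x : submod_set N x -> submod_set N (ract x (vertex_elt K a)).
    move=> Nx j jC; rewrite ractM vertex_eltM; case: eqP => [->|_]; last exact: ract0r.
    exact: Nx.
  (* An arrow from [C] to a vertex off [C] ends off [I] by closure, where the vertex space is zero;
     an arrow starting off [C] acts on a zero component. *)
  have Na al x : submod_set N x -> submod_set N (ract x (arrow_elt K al)).
    move=> Nx j jC; rewrite ractM arrow_vertex; case: eqP => [ej|_]; last exact: ract0r.
    have e : arrow_elt K al = vertex_elt K (src al) * arrow_elt K al.
      by rewrite vertex_arrow eqxx.
    have [sCal|sCal] := boolP (src al \in C); last by rewrite e -ractM Nx // ract0l.
    have jI : j \notin I.
      apply: contra jC => jI; apply: cC sCal jI _.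
      by apply/existsP; exists al; rewrite ej !eqxx.
    have -> : arrow_elt K al = arrow_elt K al * vertex_elt K j.
      by rewrite arrow_vertex ej eqxx.
    by rewrite -ractM b0.
  exists (ract_submodule Nv Na); apply/setP=> j; apply/idP/idP.
    move=> /inS[jI Nj]; apply: contraT => jC.
    by have [ebj nbj] := bI _ jI; case: nbj; rewrite -ebj; apply: Nj.
  move=> jC; apply/inS; split; first exact: sC.
  move=> i iC; have [<- _] := bI _ (sC _ jC).
  rewrite ractM vertex_eltM; case: eqP => [ij|_]; last exact: ract0r.
  by rewrite -ij jC in iC.
Qed.

End RightModules.

(** * Indecomposable representations of a line quiver *)

Section Projectors.
Variables (K : fieldType) (Q : quiver) (M : rmodType (pathalg K Q)).
Local Notation V := (restrict_scalars M).

Lemma indecomposable_projector (P : {linear V -> V}) :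
  indecomposable M -> (forall x, P (P x) = P x) ->
  (forall a x, P (ract x (vertex_elt K a)) = ract (P x) (vertex_elt K a)) ->
  (forall al x, P (ract x (arrow_elt K al)) = ract (P x) (arrow_elt K al)) ->
  (exists x, P x <> 0) -> forall x, P x = x.
Proof.
move=> [_ indM] PP Pv Pa [x0 Px0] x.
pose fix_set : set V := fun x => P x = x.
pose ker_set : set V := fun x => P x = 0.
have fix0 : fix_set 0 by exact: linear0.
have ker0 : ker_set 0 by exact: linear0.
have fixP (c : K) (y z : V) : fix_set y -> fix_set z -> fix_set (c *: y + z).
  by move=> py pz; rewrite /fix_set linearP py pz.
have kerP (c : K) (y z : V) : ker_set y -> ker_set z -> ker_set (c *: y + z).
  by move=> py pz; rewrite /ker_set linearP py pz scaler0 addr0.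
have fixv a y : fix_set y -> fix_set (ract y (vertex_elt K a)).
  by rewrite /fix_set Pv => ->.
have fixa al y : fix_set y -> fix_set (ract y (arrow_elt K al)).
  by rewrite /fix_set Pa => ->.
have kerv a y : ker_set y -> ker_set (ract y (vertex_elt K a)).
  by rewrite /ker_set Pv => ->; exact: ract0l.
have kera al y : ker_set y -> ker_set (ract y (arrow_elt K al)).
  by rewrite /ker_set Pa => ->; exact: ract0l.
pose U := @ract_submodule K Q M (Submodule fix0 fixP) fixv fixa.
pose W := @ract_submodule K Q M (Submodule ker0 kerP) kerv kera.
have [||U0|W0] := indM U W.
- apply/seteqP; split=> [y [Uy Wy]|y ->]; last by split; exact: submod0.
  by rewrite /= -Uy; exact: Wy.
- move=> y; exists (P y), (y - P y : V); split; first exact: PP.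
    by rewrite /= /ker_set linearB PP subrr.
  have e : P y + (y - P y) = y by rewrite addrC subrK.
  exact: esym e.
- case: Px0; have : submod_set U (P x0) by exact: PP.
  by rewrite U0.
have : submod_set W (x - P x : V) by rewrite /= /ker_set linearB PP subrr.
by rewrite W0 => /eqP; rewrite subr_eq0 => /eqP.
Qed.

End Projectors.

Section LineQuiver.
Variables (Q : quiver) (n : nat) (v : nat -> Q0 Q) (pos : Q0 Q -> nat) (fwd : nat -> bool).

(* [fwd k] says that edge number [k] points from vertex [k] to vertex [k.+1]. *)
Definition edge k (al : Q1 Q) : bool :=
  (src al == v (if fwd k then k else k.+1)) && (tgt al == v (if fwd k then k.+1 else k)).

(** [v] and [fwd] are total on the natural numbers but constrained only at actual vertices and
    edges, so that intervals and neighbours reduce to linear arithmetic. Arrows are not numbered;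
    [edge] ties them to edge numbers. *)
Definition line_numbering : Prop :=
  [/\ (forall a, v (pos a) = a /\ (pos a < n)%N),
      forall k, (k < n)%N -> pos (v k) = k,
      forall k, (k.+1 < n)%N -> exists al, edge k al,
      forall al, exists k, (k.+1 < n)%N /\ edge k al &
      forall k al al', edge k al -> edge k al' -> (k.+1 < n)%N -> al = al'].

Hypothesis num : line_numbering.

Lemma posK : cancel pos v. Proof. by case: num => + _ _ _ _ a => /(_ a) []. Qed.
Lemma pos_lt a : (pos a < n)%N. Proof. by case: num => + _ _ _ _ => /(_ a) []. Qed.
Lemma posv k : (k < n)%N -> pos (v k) = k. Proof. by case: num => _ + _ _ _ => /(_ k). Qed.
Lemma edge_exists k : (k.+1 < n)%N -> exists al, edge k al.
Proof. by case: num => _ _ + _ _ => /(_ k). Qed.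
Lemma arrow_edge al : exists k, (k.+1 < n)%N /\ edge k al.
Proof. by case: num => _ _ _ + _ => /(_ al). Qed.
Lemma edge_inj k al al' : (k.+1 < n)%N -> edge k al -> edge k al' -> al = al'.
Proof. by case: num => _ _ _ _ + kn h1 h2 => /(_ k al al' h1 h2 kn). Qed.

Definition pos_interval i r : {set Q0 Q} := [set a | (i <= pos a <= i + r)%N].

Section Thin.
Variables (K : fieldType) (M : rmodType (pathalg K Q)).
Local Notation V := (restrict_scalars M).
Local Notation e k := (vertex_elt K (v k)).

Definition vertex_set k : set V := fun x => ract x (e k) = x.

Lemma vertex_set0 k : vertex_set k 0.
Proof. exact: ract0l. Qed.

Lemma vertex_setP k (c : K) (x y : V) :
  vertex_set k x -> vertex_set k y -> vertex_set k (c *: x + y).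
Proof. by rewrite /vertex_set ractDl ract_scale => -> ->. Qed.

Definition vertex_space k : submodule V :=
  Submodule (@vertex_set0 k) (@vertex_setP k).

(** Always read from left to right along the line: the graph of the arrow for a forward edge, the
    converse of the graph for a backward one. *)
Definition edge_relation k (x y : V) : Prop :=
  [/\ vertex_set k x, vertex_set k.+1 y &
      exists2 al, edge k al &
        if fwd k then ract x (arrow_elt K al) = y else ract y (arrow_elt K al) = x].

Lemma edge_relation_linear k : (k.+1 < n)%N ->
  linear_relation (vertex_space k) (vertex_space k.+1) (edge_relation k).
Proof.
move=> kn; split.
- by move=> x y [].
- by move=> x y [].
- split; try exact: vertex_set0.
  by have [al eal] := edge_exists kn; exists al => //; case: ifP => _; exact: ract0l.
- move=> c x y x' y' [Wx Wy [al eal h]] [Wx' Wy' [al' eal' h']].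
  split; try exact: vertex_setP.
  exists al => //; rewrite (edge_inj kn eal eal') in h *.
  by case: ifP h h' => _ <- <-; rewrite ractDl ract_scale.
Qed.

(** The pairs of vector and functional along the line assemble into an endomorphism [P], of rank one
    at each vertex of the interval and zero elsewhere, idempotent because each functional takes the
    value 1 on its vector. Indecomposability makes [P] the identity, so each vertex space is spanned
    by its vector. *)
Lemma indecomposable_thin : indecomposable M ->
  exists i r (b : Q0 Q -> V), (i + r < n)%N /\ thin_family (pos_interval i r) b.
Proof.
move=> indM; have [[x0 nx0] _] := indM.
have ex_i : exists i, (i < n)%N && `[< exists x, submod_set (vertex_space i) x /\ x <> 0 >].
  have [a na] : exists a, ract x0 (vertex_elt K a) <> 0.
    apply: contrapT => h; apply: nx0; rewrite (ract_vertex_sum x0).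
    by apply: big1 => a _; apply: contrapT => na; apply: h; exists a.
  exists (pos a); rewrite pos_lt; apply/asboolP.
  exists (ract x0 (vertex_elt K a)); split; last exact: na.
  by rewrite /= /vertex_set posK ractM vertex_eltM eqxx.
case: (ex_minnP ex_i) => i /andP[i_lt /asboolP Wi] mini.
have Wlt k x : (k < i)%N -> vertex_set k x -> x = 0.
  move=> ki Wx; apply: contrapT => nx; have : (i <= k)%N.
    apply: mini; rewrite (ltn_trans ki i_lt); apply/asboolP; by exists x.
  by rewrite leqNgt ki.
(* [n - 1 - i] is the number of edges to the right of [v i], the leftmost vertex with a nonzero
   space. *)
have [|| r [b [psi [rt bW br bend]]]] :=
  @thin_line_exists K V (n - 1 - i)%N (fun k => vertex_space (i + k))
    (fun k => edge_relation (i + k)).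
- move=> k kt; rewrite addnS; apply: edge_relation_linear.
  by move: kt; lia.
- by rewrite addn0.
have irn : (i + r < n)%N by move: rt i_lt; lia.
pose I := pos_interval i r.
(* Extension by zero off the interval makes the projector a single sum over all vertices. The
   functionals are precomposed with the vertex idempotents so that they apply to any element of the
   module. *)
pose bb a : V := if a \in I then b (pos a - i)%N else 0.
pose phi a (x : V) : K := if a \in I then psi (pos a - i)%N (ract x (vertex_elt K a)) else 0.
have vI k : (k < n)%N -> (v k \in I) = (i <= k <= i + r)%N.
  by move=> kn; rewrite inE posv.
have bbI k : (i <= k <= i + r)%N -> bb (v k) = b (k - i)%N.
  by move=> kI; rewrite /bb vI ?kI ?posv //; move: kI irn; lia.
have phiI k x : (i <= k <= i + r)%N -> phi (v k) x = psi (k - i)%N (ract x (e k)).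
  by move=> kI; rewrite /phi vI ?kI ?posv //; move: kI irn; lia.
have bbN k : (k < n)%N -> ~~ (i <= k <= i + r)%N -> bb (v k) = 0.
  by move=> kn /negbTE kI; rewrite /bb vI // kI.
have phiN k x : (k < n)%N -> ~~ (i <= k <= i + r)%N -> phi (v k) x = 0.
  by move=> kn /negbTE kI; rewrite /phi vI // kI.
have bb_out a : a \notin I -> bb a = 0 by move=> /negbTE aI; rewrite /bb aI.
have bbv a : ract (bb a) (vertex_elt K a) = bb a.
  rewrite /bb; case: ifP => [|_]; last exact: ract0l.
  rewrite inE => aI; have [|+ _] := bW (pos a - i)%N; first by move: aI; lia.
  by rewrite /= /vertex_set subnKC ?posK //; case/andP: aI.
have phibb a : a \in I -> phi a (bb a) = 1.
  move=> aI; rewrite /phi bbv /bb aI; move: aI; rewrite inE => aI.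
  by have [|_ ->] := bW (pos a - i)%N; first by move: aI; lia.
have phi_lin a (c : K) x y : phi a (c *: x + y) = c * phi a x + phi a y.
  rewrite /phi; case: ifP => _; last by rewrite mulr0 addr0.
  by rewrite ractDl ract_scale linearP.
have phi0 a : phi a 0 = 0.
  by rewrite /phi; case: ifP => // _; rewrite (@ract0l K Q M) linear0.
have phiZ a (c : K) x : phi a (c *: x) = c * phi a x.
  by have := phi_lin a c x 0; rewrite (@addr0 V) phi0 (@addr0 K).
pose P (x : V) : V := \sum_a phi a x *: bb a.
have P_lin : linear P.
  move=> c x y; rewrite /P scaler_sumr -big_split /=; apply: eq_bigr => a _.
  by rewrite phi_lin scalerDl (@scalerA K V).
pose PL : {linear V -> V} := HB.pack P (GRing.isLinear.Build K V V *:%R P P_lin).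
have bb_neq a c : a != c -> ract (bb a) (vertex_elt K c) = 0.
  by move=> ac; rewrite -bbv ractM vertex_eltM (negbTE ac) ract0r.
have Pe a x : ract (P x) (vertex_elt K a) = phi a x *: bb a.
  rewrite /P ract_suml (bigD1 a) //= big1 => [|c ca]; last first.
    by rewrite ract_scale bb_neq // scaler0.
  by rewrite addr0 ract_scale bbv.
have phi_e a x : phi a (ract x (vertex_elt K a)) = phi a x.
  by rewrite /phi ractM vertex_eltM eqxx.
have phi_neq a c x : a != c -> phi a (ract x (vertex_elt K c)) = 0.
  move=> ac; rewrite /phi; case: ifP => // _.
  by rewrite ractM vertex_eltM eq_sym (negbTE ac) ract0r linear0.
have PP x : P (P x) = P x.
  apply: eq_bigr => a _; rewrite -(phi_e a (P x)) (Pe a x); have [aI|aI] := boolP (a \in I).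
    by rewrite phiZ (phibb a aI) mulr1.
  rewrite (bb_out a aI).
  by rewrite !(@scaler0 K V).
have Pv a x : P (ract x (vertex_elt K a)) = ract (P x) (vertex_elt K a).
  rewrite Pe /P (bigD1 a) //= phi_e big1 ?addr0 // => c ca.
  by rewrite phi_neq // scale0r.
clearbody phi bb.
have al_src al x :
    ract (ract x (vertex_elt K (src al))) (arrow_elt K al) = ract x (arrow_elt K al).
  by rewrite ractM vertex_arrow eqxx.
have al_tgt al x :
    ract (ract x (arrow_elt K al)) (vertex_elt K (tgt al)) = ract x (arrow_elt K al).
  by rewrite ractM arrow_vertex eqxx.
have step k al : (i <= k < i + r)%N -> edge k al ->
    (if fwd k then ract (b (k - i)%N) (arrow_elt K al) = b (k.+1 - i)%N
     else ract (b (k.+1 - i)%N) (arrow_elt K al) = b (k - i)%N) /\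
    forall x y, edge_relation k x y -> psi (k.+1 - i)%N y = psi (k - i)%N x.
  move=> kI ealk; have [|] := br (k - i)%N; first by move: kI; lia.
  have -> : (i + (k - i) = k)%N by move: kI; lia.
  have -> : ((k - i).+1 = k.+1 - i)%N by move: kI; lia.
  move=> [[_ _ [al' eal' h]] hpsi]; split; last exact: hpsi.
  have -> : al = al' by apply: (edge_inj _ ealk eal'); move: kI irn; lia.
  exact: h.
have edge_rel k al x : edge k al ->
    if fwd k then edge_relation k (ract x (e k)) (ract x (arrow_elt K al))
    else edge_relation k (ract x (arrow_elt K al)) (ract x (e k.+1)).
  move=> ealk; have := ealk; rewrite /edge.
  case: ifP => fk /andP[/eqP es /eqP et]; split.
  - by rewrite /vertex_set ractM vertex_eltM eqxx.
  - by rewrite /vertex_set -et al_tgt.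
  - by exists al => //; rewrite fk -es al_src.
  - by rewrite /vertex_set -et al_tgt.
  - by rewrite /vertex_set ractM vertex_eltM eqxx.
  - by exists al => //; rewrite fk -es al_src.
(* Both sides of [P (x al) = (P x) al] live at [tgt al]; this is the equality of their components
   there. *)
have key al x : phi (tgt al) (ract x (arrow_elt K al)) *: bb (tgt al) =
    phi (src al) x *: (ract (bb (src al)) (arrow_elt K al) : V).
  have [k [kn ealk]] := arrow_edge al; have kn' := ltnW kn.
  have er := edge_rel k al x ealk.
  have [kI|kI] := boolP (i <= k < i + r)%N.
    have [ebk epsi] := step k al kI ealk.
    have k0I : (i <= k <= i + r)%N by move: kI; lia.
    have k1I : (i <= k.+1 <= i + r)%N by move: kI; lia.
    have := ealk; rewrite /edge; case: ifP er ebk => fk er ebk /andP[/eqP es /eqP et].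
      have ext : ract (ract x (arrow_elt K al)) (e k.+1) = ract x (arrow_elt K al).
        by rewrite -et al_tgt.
      rewrite es et (bbI k k0I) (bbI k.+1 k1I) (phiI k _ k0I) (phiI k.+1 _ k1I).
      by rewrite ebk ext (epsi _ _ er).
    have ext : ract (ract x (arrow_elt K al)) (e k) = ract x (arrow_elt K al).
      by rewrite -et al_tgt.
    rewrite es et (bbI k k0I) (bbI k.+1 k1I) (phiI k _ k0I) (phiI k.+1 _ k1I).
    by rewrite ebk ext (epsi _ _ er).
  (* An edge not inside the interval lies to its left, crosses the left end, crosses the right end,
     or lies to its right. In the first and last case both of its vertices carry zero. *)
  have out : (k.+1 < i \/ k.+1 = i \/ k = i + r \/ i + r < k)%N by move: kI; lia.
  have zero (a c : Q0 Q) y : bb a = 0 -> bb c = 0 ->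
      phi a y *: bb a = phi c x *: (ract (bb c) (arrow_elt K al) : V).
    by move=> -> ->; rewrite (@ract0l K Q M) (@scaler0 K V (phi a y)) (@scaler0 K V (phi c x)).
  have zero2 : ~~ (i <= k <= i + r)%N -> ~~ (i <= k.+1 <= i + r)%N ->
      phi (tgt al) (ract x (arrow_elt K al)) *: bb (tgt al) =
      phi (src al) x *: (ract (bb (src al)) (arrow_elt K al) : V).
    move=> k0 k1; have := ealk; rewrite /edge; case: ifP => fk /andP[/eqP es /eqP et];
    by apply: zero; rewrite ?es ?et bbN.
  case: out => [ki|[ki|[ki|ki]]]; try by apply: zero2; move: ki; lia.
    (* Left end: the space at [v k] is zero by the choice of [i], so the arrow either starts or ends
       in zero. *)
    have k0 : ~~ (i <= k <= i + r)%N by move: ki; lia.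
    have lki : (k < i)%N by move: ki; lia.
    have := ealk; rewrite /edge; case: ifP er => fk er /andP[/eqP es /eqP et].
      rewrite es et (bbN k kn' k0) (phiN k _ kn' k0) (@scale0r K V).
      have [Wx _ _] := er.
      have -> : ract x (arrow_elt K al) = 0.
        by rewrite -al_src es (Wlt k _ lki Wx) (@ract0l K Q M).
      by rewrite phi0 (@scale0r K V).
    have := edge_rel k al (bb (src al)) ealk; rewrite fk => -[Wx _ _].
    rewrite (Wlt k _ lki Wx) et (bbN k kn' k0) (@scaler0 K V (phi (v k) _)).
    by rewrite (@scaler0 K V (phi (src al) _)).
  (* Right end: [bend] offers two reasons for stopping. A forward edge is defined on the whole
     vertex space, so [psi r (b r) = 1] excludes that [psi r] vanishes on its domain; for a backward
     edge, a relation between [b r] and 0 would give [b r = 0]. The remaining reason makes both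
     sides vanish. *)
  have k0I : (i <= k <= i + r)%N by move: ki; lia.
  have k1I : ~~ (i <= k.+1 <= i + r)%N by move: ki; lia.
  have kr : (k - i = r)%N by move: ki; lia.
  have [Wb psib] := bW r (leqnn r).
  have Wbk : ract (b r) (e k) = b r by rewrite ki; exact: Wb.
  have psi0 : psi r 0 <> 1 by rewrite linear0 => /esym/eqP; rewrite oner_eq0.
  have : edge_relation k (b r) 0 \/ forall y z, edge_relation k y z -> psi r y = 0.
    by rewrite ki; apply: bend; move: kn ki; lia.
  have := ealk; rewrite /edge; case: ifP er => fk er /andP[/eqP es /eqP et] stop.
    rewrite es et (bbN _ kn k1I) (bbI k k0I) kr (@scaler0 K V (phi (v k.+1) _)).
    case: stop => [[_ _ [al' eal']]|psi_dom].
      rewrite fk -(edge_inj kn ealk eal') => ->.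
      by rewrite (@scaler0 K V (phi (v k) x)).
    have := edge_rel k al (b r) ealk; rewrite fk Wbk => /psi_dom psib0.
    by have /eqP := psib; rewrite psib0 eq_sym oner_eq0.
  rewrite es et (bbN _ kn k1I) (@ract0l K Q M) (@scaler0 K V (phi (v k.+1) _)).
  case: stop => [[_ _ [al' eal']]|psi_dom].
    by rewrite fk (@ract0l K Q M) => b0; case: psi0; rewrite b0.
  rewrite (phiI k _ k0I) kr.
  have -> : ract (ract x (arrow_elt K al)) (e k) = ract x (arrow_elt K al).
    by rewrite -et al_tgt.
  by rewrite (psi_dom _ _ er) (@scale0r K V).
have Pa al x : P (ract x (arrow_elt K al)) = ract (P x) (arrow_elt K al).
  rewrite /P ract_suml (bigD1 (tgt al)) //= [RHS](bigD1 (src al)) //=.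
  rewrite !big1; first by rewrite !(@addr0 V) ract_scale key.
    move=> a na; rewrite ract_scale -al_src bb_neq // (@ract0l K Q M).
    exact: (@scaler0 K V).
  by move=> a na; rewrite -al_tgt phi_neq // (@scale0r K V).
have Pbb : exists x, P x <> 0.
  have iI : v i \in I by rewrite vI // leqnn leq_addr.
  exists (bb (v i)) => Pb0; have := Pe (v i) (bb (v i)).
  rewrite Pb0 (@ract0l K Q M) (phibb _ iI) (@scale1r K V) => b0.
  by have := phibb _ iI; rewrite -b0 phi0 => /esym/eqP; rewrite oner_eq0.
have Pid x : P x = x := @indecomposable_projector K Q M PL indM PP Pv Pa Pbb x.
exists i, r, bb; split; first exact: irn.
split.
- move=> a aI; split; first exact: bbv.
  by move=> ba0; have := phibb a aI; rewrite ba0 phi0 => /esym/eqP; rewrite oner_eq0.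
- by move=> a x aI; exists (phi a x); rewrite -Pe (Pid x).
- move=> a x aI; rewrite -[in LHS](Pid x) [LHS]Pe.
  rewrite (bb_out a aI).
  exact: (@scaler0 K V).
- move=> al; have [k [kn ealk]] := arrow_edge al.
  have := ealk; rewrite /edge => /andP[/eqP es /eqP et]; rewrite es et.
  have kn' := ltnW kn; case: ifP => fk; rewrite (vI _ kn) (vI _ kn') => k1 k2;
    have kI : (i <= k < i + r)%N by [move: k1 k2; lia].
    have [] := step k al kI ealk; rewrite fk => ebk _.
    by rewrite (bbI _ k1) (bbI _ k2).
  have [] := step k al kI ealk; rewrite fk => ebk _.
  by rewrite (bbI _ k1) (bbI _ k2).
Qed.
End Thin.
End LineQuiver.

(** * The full thin module *)

Section LinearExtension.
Variables (K : fieldType) (Q : quiver) (V : lmodType K) (g : qpath Q -> V).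
Local Notation A := (pathalg K Q).

Definition linear_extension (u : A) : V := \sum_(p <- msupp u) u@_p *: g p.

Lemma linear_extensionw (d : {fset qpath Q}) (u : A) : (msupp u `<=` d)%fset ->
  linear_extension u = \sum_(p <- d) u@_p *: g p.
Proof.
move=> le_d; rewrite /linear_extension (big_fset_incl _ le_d) //=.
by move=> p _ /mcoeff_outdom ->; rewrite scale0r.
Qed.

Lemma linear_extensionU c p : linear_extension << c *g p >> = c *: g p.
Proof. by rewrite (linear_extensionw msuppU_le) big_seq_fset1 mcoeffUU. Qed.

Lemma linear_extension0 : linear_extension 0 = 0.
Proof. by rewrite /linear_extension msupp0 big_seq_fset0. Qed.

Lemma linear_extensionD u v :
  linear_extension (u + v) = linear_extension u + linear_extension v.
Proof.
rewrite (linear_extensionw (msuppD_le u v)).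
rewrite (linear_extensionw (fsubsetUl (msupp u) (msupp v))).
rewrite (linear_extensionw (fsubsetUr (msupp u) (msupp v))).
by rewrite -big_split; apply: eq_bigr => p _; rewrite mcoeffD scalerDl.
Qed.

Lemma linear_extension_sum (J : Type) (s : seq J) (P : pred J) (F : J -> A) :
  linear_extension (\sum_(j <- s | P j) F j) = \sum_(j <- s | P j) linear_extension (F j).
Proof. exact: (big_morph linear_extension linear_extensionD linear_extension0). Qed.

End LinearExtension.

Section FullThinModule.
Variables (K : fieldType) (Q : quiver).
Local Notation A := (pathalg K Q).

Local Notation V := {ffun Q0 Q -> K^o}.

Definition vertex_vec (a : Q0 Q) : V := [ffun b => (b == a)%:R].

Definition thin_act (u : A) (x : V) : V :=
  linear_extension (fun p => x (pstart p) *: vertex_vec (pend p)) u.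

Lemma thin_actU c p (x : V) :
  thin_act << c *g p >> x = c *: (x (pstart p) *: vertex_vec (pend p)).
Proof. exact: linear_extensionU. Qed.

Lemma thin_actDr : right_distributive thin_act +%R.
Proof.
move=> u x y; rewrite /thin_act /linear_extension -big_split.
by apply: eq_bigr => p _; rewrite /= ffunE scalerDl scalerDr.
Qed.

Lemma thin_actDl x : {morph thin_act^~ x : u v / u + v}.
Proof. by move=> u v; exact: linear_extensionD. Qed.

Lemma thin_act_suml x (J : Type) (s : seq J) (P : pred J) (F : J -> A) :
  thin_act (\sum_(j <- s | P j) F j) x = \sum_(j <- s | P j) thin_act (F j) x.
Proof. exact: linear_extension_sum. Qed.

Lemma thin_act_sumr u (J : Type) (s : seq J) (P : pred J) (F : J -> V) :
  thin_act u (\sum_(j <- s | P j) F j) = \sum_(j <- s | P j) thin_act u (F j).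
Proof.
apply: (big_morph (thin_act u) (thin_actDr u)).
by apply: (addrI (thin_act u 0)); rewrite -thin_actDr !addr0.
Qed.

Lemma thin_act1 : left_id 1 thin_act.
Proof.
move=> x; rewrite (_ : (1 : A) = \sum_(a : Q0 Q) (<< ptriv a >> : A)) //.
rewrite thin_act_suml; apply/ffunP => b.
rewrite sum_ffunE (bigD1 b) //= big1 => [|a ab].
  by rewrite addr0 thin_actU !ffunE /pend /= eqxx scale1r -[_ *: _]/(x b * 1) mulr1.
by rewrite thin_actU !ffunE /pend /= eq_sym (negbTE ab) scale1r -[_ *: _]/(x a * 0) mulr0.
Qed.

Lemma thin_actA u v x : thin_act u (thin_act v x) = thin_act (v * u) x.
Proof.
have UA c d p q : thin_act << c *g p >> (thin_act << d *g q >> x) =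
    thin_act ((<< d *g q >> : A) * << c *g p >>) x.
  have -> : (<< d *g q >> : A) * << c *g p >> = basis_opt (d * c) (path_comp q p).
    exact: pathalg_mulUU.
  rewrite !thin_actU !ffunE; have [e|ne] := eqVneq (pend q) (pstart p).
    have [s [-> s1 s2 _]] := path_compP e.
    rewrite /= thin_actU s1 s2 !scalerA; congr (_ *: _).
    by rewrite -[_ *: 1]/(_ * 1) mulr1 mulrA [c * d]mulrC.
  rewrite path_comp_None ?(negbTE ne) //=.
  by rewrite !scaler0 scale0r scaler0 /thin_act linear_extension0.
rewrite (monalgE u) thin_act_suml mulr_sumr thin_act_suml.
apply: eq_bigr => p _; rewrite (monalgE v) mulr_suml !thin_act_suml thin_act_sumr.
by apply: eq_bigr => q _; exact: UA.
Qed.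

(* The representation with [K] at every vertex and the identity on every arrow. *)
Definition full_thin : Type := V.
HB.instance Definition _ := GRing.Zmodule.on full_thin.

HB.instance Definition _ := GRing.Zmodule_isLmodule.Build A^c full_thin
  thin_actA thin_act1 thin_actDr thin_actDl.

Lemma vertex_vec_decomp (x : V) : x = \sum_(a : Q0 Q) (x a *: vertex_vec a).
Proof.
apply/ffunP=> b; rewrite sum_ffunE (bigD1 b) //= big1 => [|a ab].
  by rewrite addr0 !ffunE eqxx -[_ *: _]/(x b * 1) mulr1.
by rewrite !ffunE eq_sym (negbTE ab) scaler0.
Qed.

Lemma thin_act_vertex a (x : V) : thin_act (vertex_elt K a) x = x a *: vertex_vec a.
Proof. by rewrite vertex_elt.unlock thin_actU scale1r. Qed.

Lemma thin_act_scale_one c x : thin_act (c *: (1 : A)) x = c *: x.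
Proof.
rewrite [RHS](vertex_vec_decomp (c *: x)) -sum_vertex_elt scaler_sumr thin_act_suml.
apply: eq_bigr => a _; rewrite vertex_elt.unlock scale_basis thin_actU.
by rewrite ffunE scalerA.
Qed.

Lemma full_thin_family : @thin_family K Q full_thin [set: Q0 Q] vertex_vec.
Proof.
split.
- move=> j _; split; last first.
    by move/ffunP/(_ j)/eqP; rewrite !ffunE eqxx oner_eq0.
  by rewrite -[LHS]/(thin_act _ _) thin_act_vertex ffunE eqxx scale1r.
- move=> j x _; exists ((x : V) j).
  rewrite -[LHS]/(thin_act _ _) thin_act_vertex.
  by rewrite -[RHS]/(thin_act _ _) thin_act_scale_one.
- by move=> j x; rewrite inE.
- move=> al _ _; rewrite -[LHS]/(thin_act _ _) arrow_elt.unlock thin_actU.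
  by rewrite ffunE eqxx !scale1r.
Qed.

Lemma full_thin_fg : finitely_generated full_thin.
Proof.
exists [seq vertex_vec a | a <- enum (Q0 Q)] => x.
(* At [y = vertex_vec a] only the term [x a] times the trivial path at [a] survives. Writing the
   coefficient as a function of the generator turns the sum over indices into a sum over
   vertices. *)
pose F (y : full_thin) : A^c := \sum_(a : Q0 Q) << (y : V) a * (x : V) a *g ptriv a >>.
exists (fun i => F [seq vertex_vec a | a <- enum (Q0 Q)]`_i).
rewrite -(big_mkord xpredT (fun i => F ([seq vertex_vec a | a <- enum (Q0 Q)]`_i) *:
  ([seq vertex_vec a | a <- enum (Q0 Q)]`_i : full_thin))).
rewrite -(big_nth 0 xpredT (fun y : full_thin => F y *: y)) big_map big_enum.
rewrite [LHS]vertex_vec_decomp; apply: eq_bigr => a _.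
rewrite -[RHS]/(thin_act _ _) thin_act_suml (bigD1 a) //= big1 => [|b ba].
  by rewrite addr0 thin_actU !ffunE eqxx mul1r scale1r.
by rewrite thin_actU ffunE (negbTE ba) mul0r scale0r.
Qed.

End FullThinModule.

(** * Sources and factor series *)

Section TopOfModel.
Variables (T : finType) (r : rel T) (h : T -> nat).
Hypothesis r_mono : forall x y, r x y -> (h x < h y)%N.
Variables (R : pzRingType) (M : lmodType R) (I : {set T}).
Variable S : submodule M -> {set T}.
Hypothesis model : closed_set_model r I S.

(** Deleting either source from [rad^k M] gives two different submodules of equal length above
    [rad^(k+1) M]. *)
Lemma two_sources_not_uniserial k x y : x != y ->
  x \in S (rad_iter M k) -> ~~ [exists z in S (rad_iter M k), r z x] ->
  y \in S (rad_iter M k) -> ~~ [exists z in S (rad_iter M k), r z y] ->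
  ~ uniserial (quotmod (rad_iter M k.+1)).
Proof.
move=> xy xJ nx yJ ny /(model_uniserial_quot r_mono model) u.
have cJ := model_closed model (rad_iter M k).
have rad_sub z : ~~ [exists w in S (rad_iter M k), r w z] ->
    S (rad_iter M k.+1) \subset S (rad_iter M k) :\ z.
  move=> nz; rewrite subsetD1 (model_rad_iter_sub model).
  by rewrite (model_rad r_mono model) inE negb_and nz orbT.
have /setP/(_ y) : S (rad_iter M k) :\ x = S (rad_iter M k) :\ y.
  apply: u; try exact: rad_sub.
  - exact: closed_in_trans cJ (closed_in_source nx).
  - exact: closed_in_trans cJ (closed_in_source ny).
  - have := cardsD1 x (S (rad_iter M k)); rewrite (cardsD1 y) xJ yJ.
    by move=> /addnI.
by rewrite !inE eqxx yJ eq_sym xy.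
Qed.

(** Outside [rad M] there are only sources, so two distinct closed sets of equal size above [rad M]
    would each contain a source missing from the other. *)
Lemma unique_source_uniserial :
  (forall x y, x \in I -> ~~ [exists z in I, r z x] ->
               y \in I -> ~~ [exists z in I, r z y] -> x = y) ->
  uniserial (quotmod (rad_iter M 1)).
Proof.
move=> uniq; apply/(model_uniserial_quot r_mono model) => C D cC cD NC ND eCD.
have source (C' D' : {set T}) z : closed_in r I C' -> S (rad_iter M 1) \subset D' ->
    z \in C' -> z \notin D' -> z \in I /\ ~~ [exists w in I, r w z].
  move=> cC' ND' zC zD; have zI := subsetP cC'.1 _ zC; split=> //.
  apply: contra zD => ez; apply: (subsetP ND' z).
  by rewrite (model_rad r_mono model) (model_rad_iter0 model) inE zI.
apply/eqP; rewrite eqEcard eCD leqnn andbT; apply: contraT => /subsetPn[z zC zD].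
have /subsetPn[w wD wC] : ~~ (D \subset C).
  apply: contra zD => DC; suff -> : D = C by [].
  by apply/eqP; rewrite eqEcard DC eCD leqnn.
have [zI nz] := source _ _ _ cC ND zC zD; have [wI nw] := source _ _ _ cD NC wD wC.
by rewrite (uniq w z) ?zC in wC.
Qed.

End TopOfModel.

(** * Heights, connectedness and sources on an oriented line *)

Section LineCombinatorics.
Variables (Q : quiver) (n : nat) (v : nat -> Q0 Q) (pos : Q0 Q -> nat) (fwd : nat -> bool).
Hypothesis num : line_numbering n v pos fwd.

Local Notation posK := (posK num).
Local Notation posv := (posv num).
Local Notation pos_lt := (pos_lt num).

(** Up to a constant, the number of forward edges minus the number of backward edges between [v 0]
    and [a]. Counting the backward edges still ahead, instead of subtracting those passed, keeps the
    value a natural number. The index [n - 1], which is no edge, adds the same amount at every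
    vertex. *)
Definition height (a : Q0 Q) : nat :=
  (\sum_(0 <= j < pos a) fwd j + \sum_(pos a <= j < n) ~~ fwd j)%N.

Lemma arrow_relP a b : arrow_rel a b <-> exists k, (k.+1 < n)%N /\
  (fwd k /\ a = v k /\ b = v k.+1 \/ ~~ fwd k /\ a = v k.+1 /\ b = v k).
Proof.
split=> [/existsP[al /andP[/eqP <- /eqP <-]]|[k [kn ab]]].
  have [k [kn /andP[/eqP es /eqP et]]] := arrow_edge num al.
  by exists k; split=> //; rewrite es et; case: (fwd k); [left|right].
have [al /andP[/eqP es /eqP et]] := edge_exists num kn.
apply/existsP; exists al; rewrite es et.
by case: ab => -[fk [-> ->]]; rewrite ?fk ?(negbTE fk) !eqxx.
Qed.

Lemma arrow_height a b : arrow_rel a b -> (height a < height b)%N.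
Proof.
move=> /arrow_relP[k [kn ab]].
have step : (height (v k) + fwd k = height (v k.+1) + ~~ fwd k)%N.
  rewrite /height (posv kn) (posv (ltnW kn)) big_nat_recr //=
    [X in (_ + X + _)%N](big_ltn (ltnW kn)).
  lia.
by case: ab => -[fk [-> ->]]; move: step; rewrite ?fk ?(negbTE fk); lia.
Qed.

Lemma pos_inj : injective pos. Proof. exact: can_inj posK. Qed.

Lemma card_vertices : #|[set: Q0 Q]| = n.
Proof.
rewrite cardsT -[RHS]card_ord.
apply: (@bij_eq_card _ _ (fun a => Ordinal (pos_lt a))).
exists (fun k : 'I_n => v k) => [a|k]; first exact: posK.
by apply: val_inj; rewrite /= posv.
Qed.

Lemma source_in (B : {set Q0 Q}) : B != set0 ->
  (forall x y, x \in B -> arrow_rel y x -> y \in B) ->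
  exists x, x \in B /\ forall y, ~~ arrow_rel y x.
Proof.
move=> /set0Pn[x0 x0B] Bin.
case: (arg_minnP height x0B) => x xB xmin; exists x; split=> // y.
by apply/negP => /[dup] /arrow_height lt /(Bin _ _ xB) /xmin; rewrite /= leqNgt lt.
Qed.

Lemma full_connected (C D : {set Q0 Q}) :
  closed_in (@arrow_rel Q) [set: Q0 Q] C -> closed_in (@arrow_rel Q) [set: Q0 Q] D ->
  C :&: D = set0 -> C :|: D = [set: Q0 Q] -> (0 < n)%N -> C = set0 \/ D = set0.
Proof.
wlog v0C : C D / v 0%N \in C.
  move=> IH cC cD CD eT n0; have : v 0%N \in C :|: D by rewrite eT inE.
  rewrite inE => /orP[v0|v0]; first exact: IH.
  by apply/or_comm; apply: IH; rewrite // 1?setIC // setUC.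
move=> [_ cC] [_ cD] CD eT _; right.
have notD a : a \in C -> a \notin D.
  by move=> aC; apply/negP => aD; have /setP/(_ a) := CD; rewrite !inE aC aD.
(* Membership in [C] spreads along the line: over a forward edge by closure of [C], and over a
   backward edge because a next vertex in [D] would pull [v k] into [D]. *)
have allC k : (k < n)%N -> v k \in C.
  elim: k => [//|k IHk] kn; have vkC := IHk (ltnW kn).
  have [fk|fk] := boolP (fwd k).
    apply: (cC (v k)) => //; apply/arrow_relP; exists k; split=> //; by left.
  have : v k.+1 \in C :|: D by rewrite eT inE.
  rewrite inE => /orP[//|vD]; have := notD _ vkC; rewrite (cD (v k.+1)) //.
  apply/arrow_relP; exists k; split=> //; by right.
apply/setP => a; rewrite inE; apply/negbTE/notD.
by rewrite -(posK a); apply/allC/pos_lt.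
Qed.

(** The edges [k] and [k.+1] both point at [v k.+1], so no arrow enters the part to its left or the
    part to its right from outside. Each part is closed under predecessors and hence contains a
    source of the whole quiver. *)
Lemma two_sources k : (k.+2 < n)%N -> fwd k -> ~~ fwd k.+1 ->
  exists x y : Q0 Q,
    [/\ x != y, forall z, ~~ @arrow_rel Q z x & forall z, ~~ @arrow_rel Q z y].
Proof.
move=> kn fk fk1.
have [||x [xB nx]] := @source_in [set a | (pos a <= k)%N].
- by apply/set0Pn; exists (v k); rewrite inE posv //; lia.
- move=> x y; rewrite !inE => xk /arrow_relP[j [jn [[fj [ey ex]]|[fj [ey ex]]]]];
  move: xk; rewrite ey ex !posv; try lia.
  have [ej|] := eqVneq j k; last lia.
  by rewrite ej fk in fj.
have [||y [yB ny]] := @source_in [set a | (k.+2 <= pos a)%N].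
- by apply/set0Pn; exists (v k.+2); rewrite inE posv //; lia.
- move=> x' y; rewrite !inE => xk /arrow_relP[j [jn [[fj [ey ex]]|[fj [ey ex]]]]];
  move: xk; rewrite ey ex !posv; try lia.
  have [ej|] := eqVneq j k.+1; last lia.
  by rewrite ej (negbTE fk1) in fj.
exists x, y; split=> //; apply/eqP => exy; move: xB yB; rewrite exy !inE; lia.
Qed.

(* No vertex is the target of two arrows. *)
Definition no_sink_pair : Prop := forall k, (k.+2 < n)%N -> fwd k -> fwd k.+1.

(** Towards a vertex of the interval further right, the edge to the right of a source points away
    from it, and without sink pairs so do all later edges. A second source to the right would be the
    target of the edge on its left. *)
Lemma interval_source i s x y : no_sink_pair -> (i + s < n)%N ->
  x \in pos_interval pos i s -> ~~ [exists z in pos_interval pos i s, arrow_rel z x] ->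
  y \in pos_interval pos i s -> ~~ [exists z in pos_interval pos i s, arrow_rel z y] -> x = y.
Proof.
move=> nsp isn; wlog lxy : x y / (pos x <= pos y)%N.
  move=> IH xI nx yI ny; have [/IH|/ltnW/IH] := leqP (pos x) (pos y); first exact.
  by move=> e; apply/esym/e.
move=> xI nx yI ny; apply: pos_inj; move: lxy; rewrite leq_eqVlt => /orP[/eqP //|lxy].
have nx' z : z \in pos_interval pos i s -> arrow_rel z x -> False.
  by move=> zI zx; case/negP: nx; apply/existsP; exists z; rewrite zI.
have ny' z : z \in pos_interval pos i s -> arrow_rel z y -> False.
  by move=> zI zy; case/negP: ny; apply/existsP; exists z; rewrite zI.
rewrite !inE in xI yI.
have fx k : (pos x <= k)%N -> (k < pos y)%N -> fwd k.
  elim: k => [|k IHk] xk ky.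
    apply: contraT => fk; exfalso; apply: (nx' (v 1)).
      by rewrite inE posv; lia.
    apply/arrow_relP; exists 0%N; split; first lia.
    right; split=> //; split=> //; rewrite -[LHS]posK; congr v; lia.
  move: xk; rewrite leq_eqVlt => /orP[/eqP exk|xk]; last first.
    by apply: nsp; [lia | apply: IHk => //; lia].
  apply: contraT => fk; exfalso; apply: (nx' (v k.+2)).
    by rewrite inE posv; lia.
  apply/arrow_relP; exists k.+1; split; first lia.
  right; split=> //; split=> //; rewrite -[LHS]posK; congr v; lia.
have py : pos y = (pos y).-1.+1 by lia.
have fy : fwd (pos y).-1 by apply: fx; lia.
exfalso; apply: (ny' (v (pos y).-1)); first by rewrite inE posv; lia.
apply/arrow_relP; exists (pos y).-1; split; first by have := pos_lt y; lia.
by left; split=> //; split=> //; rewrite -py posK.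
Qed.

End LineCombinatorics.

(** * Bounds for indecomposable modules and the modules attaining them *)

Section FactorSerial.
Variables (K : fieldType) (Q : quiver) (n : nat).
Variables (v : nat -> Q0 Q) (pos : Q0 Q -> nat) (fwd : nat -> bool).
Hypothesis num : line_numbering n v pos fwd.

Lemma indecomposable_factor_serial (M : rmodType (pathalg K Q)) : indecomposable M ->
  exists i, [/\ (0 < i <= n)%N, factor_serial M i &
    no_sink_pair n fwd -> i = 1%N \/ (i < n)%N].
Proof.
move=> /(indecomposable_thin num)[i [s [b [isn /thin_family_model[S model]]]]].
have In : (#|pos_interval pos i s| <= n)%N.
  by rewrite -(card_vertices num) subset_leq_card // subsetT.
have I0 : pos_interval pos i s != set0.
  by apply/set0Pn; exists (v i); rewrite inE (posv num) //; lia.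
have [m [mI Mm mlt]] := model_factor_serial (arrow_height num) model I0.
exists m; split=> //; first by move: mI In; lia.
move=> nsp; have [||] := mlt _; try by [left | right; lia].
apply: (unique_source_uniserial (arrow_height num) model) => x y.
exact: (interval_source num nsp isn).
Qed.

Lemma full_thin_model : exists S : submodule (full_thin K Q) -> {set Q0 Q},
  closed_set_model (@arrow_rel Q) [set: Q0 Q] S.
Proof. exact: thin_family_model (full_thin_family K Q). Qed.

Lemma full_thin_indecomposable : (0 < n)%N -> indecomposable (full_thin K Q).
Proof.
move=> n0; have [S model] := full_thin_model.
apply: (model_indecomposable model) => [|C D cC cD CD eT].
  by rewrite -card_gt0 (card_vertices num).
exact: (full_connected num).
Qed.

(** Here [l = m = n], so the factors to inspect are [M/M], which is zero, and [M/rad M], which has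
    two sources of the quiver as composition factors. *)
Lemma full_thin_factor_serial_sink k : (k.+2 < n)%N -> fwd k -> ~~ fwd k.+1 ->
  factor_serial (full_thin K Q) n.
Proof.
move=> kn fk fk1; have [S model] := full_thin_model.
have I0 : [set: Q0 Q] != set0 by rewrite -card_gt0 (card_vertices num); lia.
have J0 := model_rad_iter0 model.
split; first exact: model_nonzero model I0.
exists n; split.
  by have := model_length (arrow_height num) model; rewrite (card_vertices num).
right; rewrite subnn; split; first by lia.
  apply/(model_uniserial_quot (arrow_height num) model) => C D [CT _] [DT _].
  by rewrite J0 !subTset => /eqP-> /eqP->.
have [x [y [xy nx ny]]] := two_sources num kn fk fk1.
apply: (two_sources_not_uniserial (arrow_height num) model xy); rewrite ?J0 ?inE //.
  by apply/existsP=> -[z /andP[_]]; apply/negP.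
by apply/existsP=> -[z /andP[_]]; apply/negP.
Qed.

(** Here [l - m = 1]. The vertex [v k.+1] is the unique source, so [M/rad M] is uniserial. In
    [rad M] both neighbours of [v k.+1] become sources, since any further predecessor would produce
    a sink pair; so [M/rad^2 M] is not uniserial. *)
Lemma full_thin_factor_serial_source k : no_sink_pair n fwd ->
  (k.+2 < n)%N -> ~~ fwd k -> fwd k.+1 -> factor_serial (full_thin K Q) (n - 1).
Proof.
move=> nsp kn fk fk1; have [S model] := full_thin_model.
have I0 : [set: Q0 Q] != set0 by rewrite -card_gt0 (card_vertices num); lia.
have J0 := model_rad_iter0 model.
have fullI : [set: Q0 Q] = pos_interval pos 0 (n - 1).
  by apply/setP => a; rewrite !inE; have := pos_lt num a; lia.
split; first exact: model_nonzero model I0.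
exists n; split.
  by have := model_length (arrow_height num) model; rewrite (card_vertices num).
right; have -> : (n - (n - 1) = 1)%N by lia.
split; first by lia.
  apply: (unique_source_uniserial (arrow_height num) model) => x y.
  by rewrite fullI; apply: (interval_source num nsp); lia.
have arrowE := arrow_relP num.
have inJ1 x : x \in S (rad_iter (full_thin K Q) 1) <-> exists y, arrow_rel y x.
  rewrite (model_rad (arrow_height num) model) J0 !inE /=.
  by split=> [/existsP[y /andP[_]]|[y yx]]; [exists y | apply/existsP; exists y; rewrite inE].
have nv1 : v k.+1 \notin S (rad_iter (full_thin K Q) 1).
  apply/negP => /inJ1[y /arrowE[j [jn [[fj [_ e]]|[fj [_ e]]]]]].
    have := congr1 pos e; rewrite !(posv num); try lia.
    by move=> [ej]; rewrite ej fj in fk.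
  have := congr1 pos e; rewrite !(posv num); try lia.
  by move=> ej; rewrite -ej fk1 in fj.
have vk : v k \in S (rad_iter (full_thin K Q) 1).
  by apply/inJ1; exists (v k.+1); apply/arrowE; exists k; split; [lia | right].
have vk2 : v k.+2 \in S (rad_iter (full_thin K Q) 1).
  by apply/inJ1; exists (v k.+1); apply/arrowE; exists k.+1; split; [lia | left].
have xy : v k != v k.+2.
  by apply/eqP => /(congr1 pos); rewrite !(posv num); lia.
apply: (two_sources_not_uniserial (arrow_height num) model xy) => //.
- apply/existsP=> -[z /andP[zJ /arrowE[j [jn [[fj [ez e]]|[fj [ez e]]]]]]].
    have := congr1 pos e; rewrite !(posv num); try lia.
    by move=> ej; case/negP: fk; rewrite ej; apply: nsp => //; lia.
  have := congr1 pos e; rewrite !(posv num); try lia.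
  by move=> ej; case/negP: nv1; rewrite ej -ez.
- apply/existsP=> -[z /andP[zJ /arrowE[j [jn [[fj [ez e]]|[fj [ez e]]]]]]].
    have := congr1 pos e; rewrite !(posv num); try lia.
    by move=> [ej]; case/negP: nv1; rewrite ej -ez.
  have := congr1 pos e; rewrite !(posv num); try lia.
  by move=> ej; case/negP: fj; rewrite -ej; apply: nsp => //; lia.
Qed.

Lemma edge_position k j al : (k.+1 < n)%N -> (j.+1 < n)%N ->
  edge v fwd k al -> edge v fwd j al -> k = j.
Proof.
move=> kn jn /andP[/eqP es /eqP et] /andP[]; rewrite es et => /eqP e1 /eqP e2.
move: (congr1 pos e1) (congr1 pos e2).
by case: (fwd k); case: (fwd j); rewrite !(posv num); lia.
Qed.

Lemma sink_pair_in_arrows :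
  (exists k, [/\ (k.+2 < n)%N, fwd k & ~~ fwd k.+1]) <->
  exists b : Q0 Q, (1 < #|in_arrows b|)%N.
Proof.
split=> [[k [kn fk fk1]]|[b /card_gt1P[al [al' []]]]].
  have [al eal] := edge_exists num (ltnW kn).
  have [al' eal'] := edge_exists num kn.
  exists (v k.+1); apply/card_gt1P; exists al, al'; split.
  - by rewrite inE; have /andP[_ /eqP ->] := eal; rewrite fk.
  - by rewrite inE; have /andP[_ /eqP ->] := eal'; rewrite (negbTE fk1).
  - apply: contraTneq eal' => <-; apply/negP => eal'.
    by have := edge_position (ltnW kn) kn eal eal'; lia.
rewrite !inE => /eqP tb /eqP tb' ne.
have [k [kn eal]] := arrow_edge num al; have [j [jn eal']] := arrow_edge num al'.
have kj : k <> j.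
  by move=> e; case/eqP: ne; apply: (edge_inj num kn eal); rewrite e.
have /andP[_ /eqP tk] := eal; have /andP[_ /eqP tj] := eal'.
(* Distinct edges with a common target are neighbours pointing at each other; the positions leave
   only [j = k.+1] or [k = j.+1]. *)
have := congr1 pos (etrans (etrans (esym tk) tb) (etrans (esym tb') tj)).
case: ifP => fk; case: ifP => fj; rewrite !(posv num); try lia.
  by move=> e; exists k; rewrite fk e fj; split=> //; lia.
by move=> e; exists j; rewrite fj -e fk; split=> //; lia.
Qed.

Lemma source_pair_out_arrows (b : Q0 Q) : (1 < #|out_arrows b|)%N ->
  exists k, [/\ (k.+2 < n)%N, ~~ fwd k & fwd k.+1].
Proof.
move=> /card_gt1P[al [al' []]]; rewrite !inE => /eqP tb /eqP tb' ne.
have [k [kn eal]] := arrow_edge num al; have [j [jn eal']] := arrow_edge num al'.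
have kj : k <> j.
  by move=> e; case/eqP: ne; apply: (edge_inj num kn eal); rewrite e.
have /andP[/eqP tk _] := eal; have /andP[/eqP tj _] := eal'.
have := congr1 pos (etrans (etrans (esym tk) tb) (etrans (esym tb') tj)).
case: ifP => fk; case: ifP => fj; rewrite !(posv num); try lia.
  by move=> e; exists j; rewrite fj -e fk; split=> //; lia.
by move=> e; exists k; rewrite fk e fj; split=> //; lia.
Qed.

End FactorSerial.

(** * From the graph isomorphism with the path to a numbering, and the conclusion *)

Lemma underlying_An_numbering (Q : quiver) (n : nat) : (0 < n)%N -> underlying_An Q n ->
  exists v pos fwd, @line_numbering Q n v pos fwd.
Proof.
case: n => // n _ [f [g [[f' fK f'K] [g' gK g'K] /= fg]]].
pose v k := f (inord k); pose pos a : nat := f' a.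
(* The value [true] past the last edge is an arbitrary default. *)
pose fwd k := if insub k is Some o then src (g o : Q1 Q) == v k else true.
have posv k : (k < n.+1)%N -> pos (v k) = k by move=> kn; rewrite /pos fK inordK.
have edge_g (o : 'I_n) : edge v fwd o (g o).
  have eo : fwd o = (src (g o) == v o) by rewrite /fwd valK.
  have ok : (o < n.+1)%N by rewrite ltnW // ltnS.
  have [||[es et]|[es et]] := fg (inord o) (inord o.+1) o; rewrite ?inordK ?ltnS //.
    by rewrite /edge eo es et /v eqxx !eqxx.
  have ne : (v o.+1 == v o) = false.
    by apply/eqP => /(congr1 pos); rewrite !posv ?ltnS //; lia.
  by rewrite /edge eo es et -!/(v _) ne !eqxx.
(* The end positions of edge [k] sum to [2k + 1] in either orientation, so [k] can be recovered from
   the arrow alone. *)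
have edge_pos k al : (k.+1 < n.+1)%N -> edge v fwd k al ->
    (pos (src al) + pos (tgt al) = k.*2.+1)%N.
  move=> kn /andP[/eqP -> /eqP ->].
  by case: (fwd k); rewrite !posv //; lia.
exists v, pos, fwd; split.
- by move=> a; rewrite /v /pos inord_val f'K; split.
- exact: posv.
- by move=> k; rewrite ltnS => kn; exists (g (Ordinal kn)); exact: edge_g (Ordinal kn).
- move=> al; exists (g' al); rewrite ltnS ltn_ord; split=> //.
  by have := edge_g (g' al); rewrite g'K.
move=> k al al' eal eal' kn.
have ek al0 : edge v fwd k al0 -> g' al0 = k :> nat.
  move=> e0; have := edge_g (g' al0); rewrite g'K => e1.
  have := edge_pos _ _ kn e0; rewrite (edge_pos _ _ _ e1); first by move=> [/double_inj].
  by rewrite ltnS.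
by rewrite -(g'K al) -(g'K al'); congr g; apply: val_inj; rewrite /= !ek.
Qed.

Local Close Scope ring_scope.

Theorem proposition3p1 (K : closedFieldType) (Q : quiver) (n : nat) :
  (0 < n)%N ->
  underlying_An Q n ->
  finitely_generated (pathalg K Q : lmodType K) ->
  right_hereditary (pathalg K Q) ->
  ((forall a : Q0 Q, (#|in_arrows a| <= 1)%N) ->
   (exists b : Q0 Q, #|out_arrows b| = 2) ->
   right_Nakayama (pathalg K Q) (n - 1)) /\
  ((exists b : Q0 Q, #|in_arrows b| = 2) ->
   right_Nakayama (pathalg K Q) n).
Proof.
move=> n0 An _ _; have [v [pos [fwd num]]] := underlying_An_numbering n0 An.
have fg := full_thin_fg K Q; have ind := full_thin_indecomposable K num n0.
split=> [in1 [b b2]|[b b2]].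
  have [k [kn fk fk1]] : exists k, [/\ (k.+2 < n)%N, ~~ fwd k & fwd k.+1].
    by apply: (source_pair_out_arrows num (b := b)); rewrite b2.
  have nsp : no_sink_pair n fwd.
    move=> j jn fj; apply: contraT => fj1.
    have [|a] := (sink_pair_in_arrows num).1; first by exists j.
    by rewrite ltnNge in1.
  split.
    move=> M _ indM; have [i [i0 Mi /(_ nsp) ilt]] := indecomposable_factor_serial num indM.
    (* The alternative [i = 1] respects the bound, since [k.+2 < n] gives [n >= 3]. *)
    by exists i; split=> //; lia.
  by exists (full_thin K Q); split=> //; exact: (full_thin_factor_serial_source K num nsp kn).
have [|k [kn fk fk1]] := (sink_pair_in_arrows num).2; first by exists b; rewrite b2.
split.
  move=> M _ indM; have [i [i0 Mi _]] := indecomposable_factor_serial num indM.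
  by exists i.
by exists (full_thin K Q); split=> //; exact: (full_thin_factor_serial_sink K num kn).
Qed.
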